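(* Let $\mathbb{K}$ be a field, let $k\ge 1$ and $n\ge1$ be integers, let $H=([n],E)$ be a $k$-uniform hypergraph, and let $d\ge 2$. If $L_H^{\mathbb{K}}(d-1)$ is a complete intersection, then $L_H^{\mathbb{K}}(d)$ is a prime ideal.
   Context: A hypergraph $H=([n],E)$ has vertex set $[n]=\{1,\dots,n\}$ and edge set $E$ a set of subsets of $[n]$; it is $k$-uniform if every edge has exactly $k$ elements. For an integer $d\ge 1$ and $e\in E$ put $f_e^{(d)}=\sum_{j=1}^d\prod_{i\in e}y_{ij}$ in the polynomial ring $\mathbb{K}[y_{ij}: i\in[n], j\in[d]]$. The LSS-ideal is $L_H^{\mathbb{K}}(d)=(f_e^{(d)}: e\in E)$ in that ring. ''Complete intersection'' means that the quotient ring by $L_H^{\mathbb{K}}(d)$ is a complete intersection, i.e. the ideal is generated by a regular sequence (equivalently, its height equals $|E|$). *)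

(* Defs.v *)
From mathcomp Require Import all_boot all_order all_algebra.
From mathcomp Require Import boolp.
From mathcomp Require Import mpoly.

Set Implicit Arguments.
Unset Strict Implicit.
Unset Printing Implicit Defensive.

Import GRing.Theory.
Local Open Scope ring_scope.

Section Ideals.

Variable R : comNzRingType.

(* Membership is classical (asbool), so that the ideal predicates of
   ring_quotient, which are stated for {pred R}, apply. *)
Definition ideal_gen (s : seq R) : {pred R} :=
  [pred p : R | `[< exists c : 'I_(size s) -> R,
                      p = \sum_(i < size s) c i * s`_i >]].

Definition prime_ideal (I : {pred R}) : Prop :=
  idealr_closed I /\ prime_idealr_closed I.

(* The quotient by a regular sequence is required to be nonzero. *)
Definition regular_sequence (s : seq R) : Prop :=
  1 \notin ideal_gen s /\
  forall i : nat, (i < size s)%N -> forall g : R,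
    s`_i * g \in ideal_gen (take i s) -> g \in ideal_gen (take i s).

Definition complete_intersection (I : {pred R}) : Prop :=
  exists2 s : seq R, regular_sequence s & I =i ideal_gen s.

End Ideals.

Definition uniform (n k : nat) (E : {set {set 'I_n}}) : Prop :=
  forall e : {set 'I_n}, e \in E -> #|e| = k.

Section LSS.

Variables (K : fieldType) (n d : nat).

(* The n * d variables y_ij are numbered by the bijection
   mxvec_index : 'I_n -> 'I_d -> 'I_(n * d). *)
Definition lss_var (i : 'I_n) (j : 'I_d) : {mpoly K[n * d]} :=
  'X_(mxvec_index i j).

Definition lss_form (e : {set 'I_n}) : {mpoly K[n * d]} :=
  \sum_(j < d) \prod_(i in e) lss_var i j.

Definition lss_ideal (E : {set {set 'I_n}}) : {pred {mpoly K[n * d]}} :=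
  ideal_gen [seq lss_form e | e <- enum E].

End LSS.

Arguments lss_form K {n} d e.
Arguments lss_ideal K {n} d E.

(* Main.v *)
(* Split off the last column: f_e^(d) = f'_e + z^e, where f'_e is the form in the first
   d - 1 columns and z is the last one. As the f'_e are homogeneous and generate a
   complete intersection, their Koszul relations are exact, so they form a regular
   sequence in any order, also over the larger ring.

   Induct on the edges: fix a vertex v lying on some edge. The ideal L0 of the edges
   avoiding v is prime, and the t forms of the edges through v are linear in the
   variables of v, with coefficient matrix [G | Z] over the other variables, where Z
   consists of the distinct monomials z^(e - v). Where a maximal minor of G is
   invertible, Cramer's rule makes the quotient by L = L_H(d) a polynomial ring over a
   localisation of the quotient by L0. So L is prime as soon as an element killed modulo
   L by all t-minors of G lies in L.

   For that, first degenerate f_e to f'_e for the edges avoiding v. Suppose that h is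
   killed by all (s+1)-minors, and let D be an s-minor. Bordering D gives, for every other
   edge e, elements b'_e (a combination of the f') and c_e = D Z_e + ... with
   b'_e + z_v c_e in the ideal and with both b'_e and c_e killing h. In the localisation
   at D, exchange the generators b'_e + z_v c_e for b'_e one at a time: h becomes an
   element killed by c_e modulo the f', where c_e is a nonzerodivisor because its leading
   term D Z_e is one. So a power of D kills h, and one descends from s+1 to s. *)

Require Import Defs.
From mathcomp Require Import all_boot all_order all_algebra.
From mathcomp Require Import boolp.
From mathcomp Require Import mpoly.
From mathcomp Require Import ring.

Set Implicit Arguments.
Unset Strict Implicit.
Unset Printing Implicit Defensive.

Import GRing.Theory.
Local Open Scope ring_scope.

(** * Ideals and their saturations *)

Section IdealTheory.

Variable R : comNzRingType.
Implicit Types (I : R -> Prop) (s : seq R) (p q u v d : R).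

Record ideal I : Prop := Ideal {
  ideal0 : I 0;
  idealD : forall p q, I p -> I q -> I (p + q);
  ideal_mull : forall c p, I p -> I (c * p) }.

Lemma idealN I : ideal I -> forall p, I p -> I (- p).
Proof. by move=> iI p Ip; rewrite -mulN1r; apply: ideal_mull. Qed.

Lemma idealB I : ideal I -> forall p q, I p -> I q -> I (p - q).
Proof. by move=> iI p q Ip Iq; apply: idealD => //; apply: idealN. Qed.

Lemma idealBK I : ideal I -> forall p q, I q -> I (p - q) -> I p.
Proof. by move=> iI p q Iq Ipq; rewrite -(subrK q p); apply: idealD. Qed.

Lemma ideal_mulr I : ideal I -> forall c p, I p -> I (p * c).
Proof. by move=> iI c p Ip; rewrite mulrC; apply: ideal_mull. Qed.

Lemma ideal_sum I (T : Type) (r : seq T) (P : pred T) (F : T -> R) :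
  ideal I -> (forall i, P i -> I (F i)) -> I (\sum_(i <- r | P i) F i).
Proof.
move=> iI IF; apply: (big_ind I) => //; first exact: ideal0.
exact: idealD.
Qed.

(** The recursion suits adjoining one generator at a time; [idlP] identifies the result with
    [ideal_gen]. *)
Fixpoint idl s p : Prop :=
  if s is u :: s' then exists c, idl s' (p - c * u) else p = 0.

Lemma idl_ideal s : ideal (idl s).
Proof.
elim: s => [|u s [I0 ID IM]]; split => //=.
- by move=> _ _ -> ->; rewrite addr0.
- by move=> c p ->; rewrite mulr0.
- by exists 0; rewrite mul0r subr0.
- move=> p q [c Ic] [c' Ic']; exists (c + c').
  by rewrite mulrDl opprD addrACA; apply: ID.
- by move=> c p [c' Ic']; exists (c * c'); rewrite -mulrA -mulrBr; apply: IM.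
Qed.

Lemma idl_mem s u : u \in s -> idl s u.
Proof.
elim: s => //= v s IHs; rewrite inE => /orP[/eqP->|us].
  by exists 1; rewrite mul1r subrr; apply: ideal0 (idl_ideal s).
by exists 0; rewrite mul0r subr0; apply: IHs.
Qed.

Lemma idl_sub I s p : ideal I -> (forall u, u \in s -> I u) -> idl s p -> I p.
Proof.
move=> iI; elim: s p => [|u s IHs] p Is /=; first by move=> ->; apply: ideal0.
case=> c /IHs Ipc; apply: (idealBK iI (q := c * u)).
  by apply: ideal_mull => //; apply: Is; rewrite mem_head.
by apply: Ipc => v vs; apply: Is; rewrite inE vs orbT.
Qed.

Lemma idlP s p : (p \in ideal_gen s) <-> idl s p.
Proof.
rewrite /ideal_gen inE; split=> [/asboolP[c ->]|ps].
  apply: ideal_sum => [|i _]; first exact: idl_ideal.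
  by apply: ideal_mull; [apply: idl_ideal | apply/idl_mem/mem_nth].
apply/asboolP; elim: s p ps => [|u s IHs] p /=.
  by move=> ->; exists (fun=> 0); rewrite big_ord0.
case=> c /IHs[b eqb].
exists (fun i : 'I_(size s).+1 => if unlift ord0 i is Some j then b j else c).
rewrite big_ord_recl unlift_none /= -(subrK (c * u) p) eqb addrC.
by congr (_ + _); apply: eq_bigr => i _; rewrite liftK.
Qed.

(* The saturation at d of the ideal generated by s. *)
Definition sgen d s p : Prop := exists N, idl s (d ^+ N * p).

Lemma sgen_ideal d s : ideal (sgen d s).
Proof.
have iI := idl_ideal s; split.
- by exists 0; rewrite mulr0; apply: ideal0.
- move=> p q [N Ip] [M Iq]; exists (N + M)%N; rewrite mulrDr.
  apply: idealD => //; first by rewrite addnC exprD -mulrA; apply: ideal_mull.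
  by rewrite exprD -mulrA; apply: ideal_mull.
- by move=> c p [N Ip]; exists N; rewrite mulrCA; apply: ideal_mull.
Qed.

Lemma sgen_idl d s p : idl s p -> sgen d s p.
Proof. by exists 0; rewrite expr0 mul1r. Qed.

Lemma sgen_mem d s u : u \in s -> sgen d s u.
Proof. by move=> us; apply/sgen_idl/idl_mem. Qed.

Lemma sgen_sat d s N p : sgen d s (d ^+ N * p) -> sgen d s p.
Proof. by case=> M Ip; exists (M + N)%N; rewrite exprD -mulrA. Qed.

Lemma sgen_sat1 d s p : sgen d s (d * p) -> sgen d s p.
Proof. by move=> Ip; apply: (@sgen_sat d s 1); rewrite expr1. Qed.

Lemma sgen1 s p : sgen 1 s p <-> idl s p.
Proof.
by split=> [[N]|]; [rewrite expr1n mul1r | apply: sgen_idl].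
Qed.

Lemma sgen_sub d s s' p :
  (forall u, u \in s -> sgen d s' u) -> sgen d s p -> sgen d s' p.
Proof.
by move=> ss' [N /(idl_sub (sgen_ideal d s') ss')]; apply: sgen_sat.
Qed.

Lemma sgen_subset d s s' p : {subset s <= s'} -> sgen d s p -> sgen d s' p.
Proof. by move=> ss'; apply: sgen_sub => u /ss'; apply: sgen_mem. Qed.

Lemma idl_subset s s' p : {subset s <= s'} -> idl s p -> idl s' p.
Proof.
by move=> ss'; apply: idl_sub => [|u /ss']; [apply: idl_ideal | apply: idl_mem].
Qed.

Lemma sgen_cons d u s p :
  sgen d (u :: s) p <-> exists N c, sgen d s (d ^+ N * p - c * u).
Proof.
split=> [[N [c Ic]]|[N [c [M]]]].
  by exists N, c; apply: sgen_idl.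
rewrite mulrBr mulrA -exprD => Ic; exists (M + N)%N, (d ^+ M * c).
by rewrite -mulrA.
Qed.

(** [I] may be the whole ring; then every element qualifies, even 0. *)
Definition nzd I u := forall g, I (u * g) -> I g.

Lemma nzd_sgen d s u : nzd (idl s) u -> nzd (sgen d s) u.
Proof. by move=> zu g [N]; rewrite mulrCA => /zu; exists N. Qed.

Lemma nzdM I u v : nzd I u -> nzd I v -> nzd I (u * v).
Proof. by move=> zu zv g; rewrite -mulrA => /zu/zv. Qed.

Lemma nzd1 I : nzd I 1.
Proof. by move=> g; rewrite mul1r. Qed.

Lemma nzd_prod I (T : Type) (r : seq T) (P : pred T) (F : T -> R) :
  (forall i, P i -> nzd I (F i)) -> nzd I (\prod_(i <- r | P i) F i).
Proof. by move=> zF; apply: (big_ind (nzd I)) => //; [apply: nzd1 | apply: nzdM]. Qed.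

Lemma nzd_mod I u v : ideal I -> I (u - v) -> nzd I u -> nzd I v.
Proof.
move=> iI Iuv zu g Ivg; apply: zu; rewrite -(subrK v u) mulrDl.
by apply: idealD => //; apply: ideal_mulr.
Qed.

Lemma eq_nzd I I' u : (forall p, I p <-> I' p) -> nzd I u -> nzd I' u.
Proof. by move=> eqI zu g /eqI/zu/eqI. Qed.

(* If u and v are both regular modulo s, multiplication by v / u identifies the
   elements annihilated by J modulo (u, s) and modulo (v, s). *)
Lemma exchange (J : R -> Prop) d s u v :
    nzd (sgen d s) u -> nzd (sgen d s) v -> J v ->
    (forall h, (forall a, J a -> sgen d (v :: s) (a * h)) -> sgen d (v :: s) h) ->
  forall h, (forall a, J a -> sgen d (u :: s) (a * h)) -> sgen d (u :: s) h.
Proof.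
have iS := sgen_ideal d s.
move=> zu zv Jv IH h Jh.
have /sgen_cons[N [h' Ih']] := Jh v Jv.
have /sgen_cons[M [k Ik]] : sgen d (v :: s) h'.
  apply: IH => a Ja; have /sgen_cons[M [c Ic]] := Jh a Ja.
  apply/sgen_cons; exists M, (d ^+ N * c); apply: zu.
  have -> : u * (d ^+ M * (a * h') - d ^+ N * c * v) =
    (d ^+ N * v) * (d ^+ M * (a * h) - c * u)
    - (d ^+ M * a) * (d ^+ N * (v * h) - h' * u) by ring.
  by apply: idealB => //; apply: ideal_mull.
apply/sgen_cons; exists (N + M)%N, k; apply: zv.
have -> : v * (d ^+ (N + M) * h - k * u) =
  d ^+ M * (d ^+ N * (v * h) - h' * u) + u * (d ^+ M * h' - k * v).
  by rewrite exprD; ring.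
by apply: idealD => //; apply: ideal_mull.
Qed.

(** Induction on the sum of the exponents: multiplying [h] by [D i] lowers the exponent at [i] by
    one, so [D i * h] lies in [I] for every [i], and the hypothesis on [I] applies to [h]. *)
Lemma annihilator_power (T : finType) (D : T -> R) I :
    ideal I -> (forall h, (forall i, I (D i * h)) -> I h) ->
  forall h, (forall i, exists N, I (D i ^+ N * h)) -> I h.
Proof.
move=> iI HI h /choice[N]; move: {2}(\sum_i N i)%N (leqnn (\sum_i N i)%N) => m.
elim: m h N => [|m IHm] h N leNm Ih; apply: HI => i.
  have := Ih i; have -> : N i = 0%N.
    by apply/eqP; rewrite -leqn0; apply: leq_trans leNm; rewrite (bigD1 i) ?leq_addr.
  by rewrite expr0 mul1r; apply: ideal_mull.
have := Ih i; case Ni: (N i) => [|k]; first by rewrite expr0 mul1r; apply: ideal_mull.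
move=> Ihk.
apply: (IHm _ (fun j => if j == i then k else N j)) => [|j].
  rewrite -ltnS; apply: leq_trans leNm; rewrite (bigD1 i) //= eqxx.
  rewrite [X in (_ < X)%N](bigD1 i) //= Ni addSn ltnS leq_add2l.
  by apply: leq_sum => j /negPf ->.
case: eqP => [->|_]; first by rewrite mulrA -exprSr.
by rewrite mulrCA; apply: ideal_mull.
Qed.

End IdealTheory.

(** * Gradings and initial ideals *)

(* A grading of P by the natural numbers, encoded by the ring morphism sending a
   homogeneous p of weight w to p * X^w. *)
Record grading (P : idomainType) := Grading {
  gr :> {rmorphism P -> {poly P}};
  gr_horner1 : forall p, (gr p).[1] = p;
  gr_coef : forall p i, gr (gr p)`_i = ((gr p)`_i)%:P * 'X^i }.

Section GradingTheory.

Variables (P : idomainType) (phi : grading P).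
Implicit Types (p q f F g c d : P) (w : nat).

Definition ishom w p := phi p = p%:P * 'X^w.

(* F is the homogeneous component of weight w of f, and f has no component of
   larger weight; F may vanish. *)
Definition lead_form w F f := ishom w F /\ (size (phi (f - F)%R) <= w)%N.

Lemma gr_eq0 p : (phi p == 0) = (p == 0).
Proof.
apply/eqP/eqP => [p0|->]; last exact: rmorph0.
by rewrite -(gr_horner1 phi p) p0 horner0.
Qed.

Lemma hom0 w : ishom w 0.
Proof. by rewrite /ishom rmorph0 polyC0 mul0r. Qed.

Lemma hom1 : ishom 0 1.
Proof. by rewrite /ishom rmorph1 expr0 mulr1. Qed.

Lemma homD w p q : ishom w p -> ishom w q -> ishom w (p + q).
Proof. by rewrite /ishom rmorphD polyCD mulrDl => -> ->. Qed.

Lemma homN w p : ishom w p -> ishom w (- p).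
Proof. by rewrite /ishom rmorphN polyCN mulNr => ->. Qed.

Lemma homB w p q : ishom w p -> ishom w q -> ishom w (p - q).
Proof. by move=> hp hq; apply: homD => //; apply: homN. Qed.

Lemma homM w w' p q : ishom w p -> ishom w' q -> ishom (w + w') (p * q).
Proof. by rewrite /ishom rmorphM polyCM exprD => -> ->; rewrite mulrACA. Qed.

Lemma hom0M w p q : ishom 0 p -> ishom w q -> ishom w (p * q).
Proof. exact: homM. Qed.

Lemma hom_sum w (T : Type) (r : seq T) (Q : pred T) (F : T -> P) :
  (forall i, Q i -> ishom w (F i)) -> ishom w (\sum_(i <- r | Q i) F i).
Proof.
by move=> hF; apply: (big_ind (ishom w)) => //; [apply: hom0 | apply: homD].
Qed.

Lemma hom_prod (T : Type) (r : seq T) (Q : pred T) (F : T -> P) (w : T -> nat) :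
  (forall i, Q i -> ishom (w i) (F i)) ->
  ishom (\sum_(i <- r | Q i) w i) (\prod_(i <- r | Q i) F i).
Proof.
by move=> hF; apply: big_ind2 => //; [apply: hom1 | move=> *; apply: homM].
Qed.

Lemma homX w p N : ishom w p -> ishom (N * w) (p ^+ N).
Proof.
move=> hp; elim: N => [|N IHN]; first exact: hom1.
by rewrite exprS mulSn; apply: homM.
Qed.

Lemma hom_det w m (M : 'M[P]_m) :
  (forall i j, ishom w (M i j)) -> ishom (m * w) (\det M).
Proof.
move=> hM; apply: hom_sum => s _; rewrite -[(m * w)%N]add0n.
apply: homM; first by have := homX (perm.odd_perm s) (homN hom1); rewrite muln0.
have -> : (m * w = \sum_(i < m) w)%N by rewrite sum_nat_const card_ord.
exact: hom_prod.
Qed.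

Lemma hom_coef p i : ishom i (phi p)`_i.
Proof. exact: gr_coef. Qed.

Lemma hom_top p : ishom (size (phi p)).-1 (lead_coef (phi p)).
Proof. exact: hom_coef. Qed.

Lemma hom_lead w p : ishom w p -> lead_form w p p.
Proof. by move=> hp; split=> //; rewrite subrr rmorph0 size_poly0. Qed.

Lemma size_hom w p : ishom w p -> (size (phi p) <= w.+1)%N.
Proof. by move->; rewrite mul_polyC (leq_trans (size_scale_leq _ _)) ?size_polyXn. Qed.

Lemma size_hom_leq w w' p : ishom w p -> (w < w')%N -> (size (phi p) <= w')%N.
Proof. by move=> /size_hom h1 h2; apply: leq_trans h2. Qed.

Lemma size_homM w p q : ishom 0 p ->
  (size (phi q) <= w)%N -> (size (phi (p * q)%R) <= w)%N.
Proof.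
rewrite /ishom expr0 mulr1 => hp hq.
by rewrite rmorphM /= hp mul_polyC (leq_trans (size_scale_leq _ _)).
Qed.

Lemma size_grD w p q : (size (phi p) <= w)%N -> (size (phi q) <= w)%N ->
  (size (phi (p + q)%R) <= w)%N.
Proof.
by move=> hp hq; rewrite rmorphD (leq_trans (size_polyD _ _)) // geq_max hp hq.
Qed.

Lemma size_grN w p : (size (phi p) <= w)%N -> (size (phi (- p)%R) <= w)%N.
Proof. by rewrite rmorphN size_polyN. Qed.

Lemma size_gr_sum w (T : Type) (r : seq T) (Q : pred T) (F : T -> P) :
  (forall i, Q i -> (size (phi (F i)) <= w)%N) ->
  (size (phi (\sum_(i <- r | Q i) F i)%R) <= w)%N.
Proof.
move=> hF; apply: (big_ind (fun p => size (phi p) <= w)%N) => //.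
  by rewrite rmorph0 size_poly0.
by move=> p q; apply: size_grD.
Qed.

Lemma lead_form_coef w F f : lead_form w F f -> (phi f)`_w = F.
Proof.
case=> hF sz; rewrite -[f](subrK F) rmorphD coefD nth_default // add0r hF.
by rewrite coefMXn ltnn subnn coefC eqxx.
Qed.

Lemma lead_form_size w F f : lead_form w F f -> (size (phi f) <= w.+1)%N.
Proof.
by case=> hF sz; rewrite -[f](subrK F); apply: size_grD;
  [apply: leqW | apply: size_hom].
Qed.

Lemma lead_form_top w F f : lead_form w F f -> F != 0 ->
  size (phi f) = w.+1 /\ lead_coef (phi f) = F.
Proof.
move=> lF F0; have sz : size (phi f) = w.+1.
  apply/eqP; rewrite eqn_leq (lead_form_size lF) ltnNge; apply/negP => sz.
  by case/eqP: F0; rewrite -(lead_form_coef lF) nth_default.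
by split=> //; rewrite /lead_coef sz (lead_form_coef lF).
Qed.

Section Initial.

Variable d : P.
Hypotheses (d_hom : ishom 0 d) (d_neq0 : d != 0).

Lemma gr_dX N p : phi (d ^+ N * p) = (d ^+ N) *: phi p.
Proof.
have := homX N d_hom; rewrite muln0 /ishom expr0 mulr1 rmorphM /= => ->.
by rewrite mul_polyC.
Qed.

Lemma size_gr_dX N p : size (phi (d ^+ N * p)) = size (phi p).
Proof. by rewrite gr_dX size_scale // expf_neq0. Qed.

(* The second components generate the ideal of leading forms of the ideal generated by
   the first components, up to saturation at d. *)
Definition initial (ps : seq (P * P)) :=
  let X := sgen d (map fst ps) in let Y := sgen d (map snd ps) in
  [/\ forall p i, Y p -> Y (phi p)`_i,
      forall p, X p -> Y (lead_coef (phi p)) &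
      forall p, p != 0 -> Y (lead_coef (phi p)) ->
        exists N x, X x /\ (size (phi (d ^+ N * p - x)%R) < size (phi p))%N].

Lemma initial_nil : initial [::].
Proof.
have X0 p : sgen d [::] p -> p = 0.
  by case=> N /eqP; rewrite mulf_eq0 expf_eq0 (negPf d_neq0) andbF => /eqP.
split=> [p i /X0 ->|p /X0 ->|p p0 /X0/eqP].
- by rewrite rmorph0 coef0; apply: ideal0 (sgen_ideal _ _).
- by rewrite rmorph0 lead_coef0; apply: ideal0 (sgen_ideal _ _).
- by rewrite lead_coef_eq0 gr_eq0 (negPf p0).
Qed.

(** Let [f * g] lie in the first ideal. Then [F] times the leading form of [g] lies in the second,
    hence so does that leading form, and [g] can be replaced, up to a power of [d], by an element of
    smaller size. *)
Lemma nzd_initial ps w f F : initial ps -> lead_form w F f ->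
  nzd (sgen d (map snd ps)) F -> nzd (sgen d (map fst ps)) f.
Proof.
case=> _ D1 D2 lF zF g; move: {2}(size _) (leqnn (size (phi g))) => m.
have iX := sgen_ideal d (map fst ps).
elim: m g => [|m IHm] g szg Xfg.
  move: szg; rewrite leqn0 size_poly_eq0 gr_eq0 => /eqP ->; exact: ideal0 iX.
have [->|g0] := eqVneq g 0; first exact: ideal0 iX.
have /D2[|N [x [Xx szx]]] : sgen d (map snd ps) (lead_coef (phi g)) => //.
  apply: zF; have [->|F0] := eqVneq F 0.
    by rewrite mul0r; apply: ideal0 (sgen_ideal _ _).
  have [_ <-] := lead_form_top lF F0.
  by rewrite -lead_coefM -rmorphM; apply: D1.
apply: (@sgen_sat _ _ _ N); apply: (idealBK iX Xx); apply: IHm.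
  by rewrite -ltnS; apply: leq_trans szg.
rewrite mulrBr mulrCA; apply: idealB => //; apply: ideal_mull => //.
Qed.

(** The difficulty is cancellation of leading terms in [x + c f], with [x] in the old ideal [X]. It
    puts [F] times the leading form of [c] in [Y], so, [F] being regular there, [c] can be lowered
    modulo [X] while [x] is changed accordingly. *)
Lemma initial_cons ps w f F : initial ps -> lead_form w F f ->
  nzd (sgen d (map snd ps)) F -> initial ((f, F) :: ps).
Proof.
case=> D0 D1 D2 lF zF; rewrite /initial /=.
set X := sgen d (map fst ps) in D0 D1 D2 zF *.
set Y := sgen d (map snd ps) in D0 D1 D2 zF *.
set X' := sgen d (f :: _); set Y' := sgen d (F :: _).
have iX : ideal X := sgen_ideal _ _; have iY : ideal Y := sgen_ideal _ _.
have iX' : ideal X' := sgen_ideal _ _; have iY' : ideal Y' := sgen_ideal _ _.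
have XX' p : X p -> X' p by apply: sgen_subset => q qs; rewrite inE qs orbT.
have YY' p : Y p -> Y' p by apply: sgen_subset => q qs; rewrite inE qs orbT.
have X'f : X' f by apply: sgen_mem; rewrite mem_head.
have Y'F : Y' F by apply: sgen_mem; rewrite mem_head.
have hF : ishom w F by case: lF.
have comp p i : Y' p ->
    exists N c, Y (d ^+ N * (phi p)`_i - c * F) /\
      ((w <= i)%N /\ ishom (i - w) c \/ c = 0).
  case/sgen_cons=> N [c /(D0 _ i)].
  rewrite rmorphB gr_dX /= coefB coefZ rmorphM /= hF mulrA coefMXn coefMC => Yc.
  exists N; case: ltnP Yc => [_|wi] Yc; last first.
    by exists ((phi c)`_(i - w)); split=> //; left; split=> //; apply: hom_coef.
  by exists 0; rewrite mul0r; split=> //; right.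
split.
- move=> p i /(comp p i)[N [c [Yc _]]]; apply: (@sgen_sat _ _ _ N).
  by apply: (idealBK iY' (q := c * F)); [apply: ideal_mull | apply: YY'].
- move=> p /sgen_cons[N [c]]; move: {2}(size _) (leqnn (size (phi c))) => m.
  (* If [F = 0] is regular modulo [Y], then [Y] is the whole ring. *)
  have [F0|F0] := eqVneq F 0.
    by move=> _ _; apply/YY'/zF; rewrite F0 mul0r; apply: ideal0.
  have [szf lcf] := lead_form_top lF F0.
  elim: m N c => [|m IHm] N c.
    rewrite leqn0 size_poly_eq0 gr_eq0 => /eqP ->; rewrite mul0r subr0.
    by move=> /sgen_sat/D1/YY'.
  move=> szc Xx; set x := d ^+ N * p - c * f in Xx.
  have [->|p0] := eqVneq p 0; first by rewrite rmorph0 lead_coef0; apply: ideal0.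
  have sp0 : (0 < size (phi p))%N by rewrite size_poly_gt0 gr_eq0.
  have [le_cf_p|lt_p_cf] := leqP (size (phi (c * f)%R)) (size (phi p)).
    set i := (size (phi p)).-1; apply: (@sgen_sat _ _ _ N).
    have Yxi : Y (phi x)`_i.
      have : (size (phi x) <= i.+1)%N.
        rewrite prednK // /x; apply: size_grD; first by rewrite size_gr_dX.
        exact: size_grN.
      rewrite leq_eqVlt ltnS => /orP[/eqP szx|szx].
        by have := D1 _ Xx; rewrite /lead_coef szx.
      by rewrite nth_default //; apply: ideal0.
    move: Yxi; rewrite rmorphB gr_dX coefB coefZ => /YY'; apply: idealBK => //.
    move: le_cf_p; rewrite leq_eqVlt => /orP[/eqP eqs|lts].
      have := lead_coefM (phi c) (phi f); rewrite lcf -rmorphM /lead_coef eqs => ->.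
      by apply: ideal_mull.
    by rewrite nth_default ?prednK // -1?ltnS ?prednK //; apply: ideal0.
  (* Here [c f] dominates, so its leading form is, up to sign, that of [x], and [c] can be
     lowered. *)
  have szx : (size (phi (d ^+ N * p)%R) < size (phi (- (c * f))%R))%N
    by rewrite size_gr_dX rmorphN size_polyN.
  have Yc : Y (lead_coef (phi c)).
    apply: zF; rewrite -lcf mulrC -lead_coefM -rmorphM.
    have := idealN iY (D1 _ Xx).
    by rewrite rmorphD lead_coefDr // rmorphN lead_coefN opprK.
  have c0 : c != 0.
    by apply: contraTneq lt_p_cf => ->; rewrite mul0r rmorph0 size_poly0.
  have [M [y [Xy szy]]] := D2 _ c0 Yc.
  apply: (IHm (M + N)%N (d ^+ M * c - y)).
    by rewrite -ltnS; apply: leq_trans szc.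
  have -> : d ^+ (M + N) * p - (d ^+ M * c - y) * f = d ^+ M * x + f * y.
    by rewrite exprD /x; ring.
  by apply: idealD => //; apply: ideal_mull.
- move=> p p0 Yp; set i := (size (phi p)).-1.
  have sp : i.+1 = size (phi p) by rewrite prednK // size_poly_gt0 gr_eq0.
  have [N [c [Yc hc]]] := comp _ i Yp.
  have cE : (phi (lead_coef (phi p)))`_i = lead_coef (phi p).
    by rewrite hom_top coefMXn ltnn subnn coefC eqxx.
  rewrite cE in Yc; set p' := d ^+ N * p - c * f.
  have szcf : (size (phi (c * f)%R) <= i.+1)%N /\ (phi (c * f)%R)`_i = c * F.
    case: hc => [[wi hc]|->]; last by rewrite !mul0r rmorph0 size_poly0 coef0.
    have -> : phi (c * f) = c *: (phi f * 'X^(i - w)).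
      by rewrite rmorphM /= hc -mulrA mul_polyC mulrC.
    rewrite coefZ coefMXn ltnNge leq_subr /= subKn // (lead_form_coef lF).
    split=> //; apply: leq_trans (size_scale_leq _ _) _.
    have := size_polyMleq (phi f) ('X^(i - w) : {poly P}).
    rewrite size_polyXn addnS /= => le1; apply: leq_trans le1 _.
    by rewrite -[X in (_ <= X.+1)%N](subnKC wi) -addSn leq_add2r (lead_form_size lF).
  case: szcf => szcf cfi.
  have szp' : (size (phi p') <= i.+1)%N.
    by apply: size_grD; [rewrite size_gr_dX sp | apply: size_grN].
  have p'i : Y (phi p')`_i by rewrite rmorphB coefB gr_dX coefZ cfi.
  have [lt|ge] := ltnP (size (phi p')) (size (phi p)).
    by exists N, (c * f); split=> //; apply: ideal_mull.
  have szE : size (phi p') = i.+1 by apply/eqP; rewrite eqn_leq szp' sp.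
  have p'0 : p' != 0 by rewrite -gr_eq0 -size_poly_eq0 szE.
  have [|M [x [Xx szx]]] := D2 _ p'0; first by rewrite /lead_coef szE.
  exists (M + N)%N, (d ^+ M * (c * f) + x); split.
    by apply: idealD; [|apply: ideal_mull => //; apply: ideal_mull|apply: XX'].
  rewrite -sp -szE; suff -> : d ^+ (M + N) * p - (d ^+ M * (c * f) + x) =
    d ^+ M * p' - x by [].
  by rewrite exprD /p'; ring.
Qed.

(** The sequence runs from the end of the list to its head, opposite to [regular_sequence], and the
    quotient may be zero. *)
Fixpoint regseq (s : seq P) : Prop :=
  if s is u :: s' then nzd (sgen d s') u /\ regseq s' else True.

Lemma initial_regseq ps :
    (forall q : P * P, q \in ps -> exists w, lead_form w q.2 q.1) ->
  regseq (map snd ps) -> initial ps.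
Proof.
elim: ps => [|[f F] ps IHps] lps; first by move=> _; apply: initial_nil.
case=> zF rps; have [w lF] := lps _ (mem_head _ _).
by apply: initial_cons lF zF; apply: IHps => // q qs; apply: lps; rewrite inE qs orbT.
Qed.

(** Each [D i] is homogeneous, hence kills the leading form of [h] modulo the second components;
    that form then lies in the initial ideal, and [h] can be lowered. *)
Lemma annihilator_initial ps (T : Type) (D : T -> P) :
    initial ps -> (forall i, exists w, ishom w (D i)) ->
    (forall h, (forall i, sgen d (map snd ps) (D i * h)) -> sgen d (map snd ps) h) ->
  forall h, (forall i, sgen d (map fst ps) (D i * h)) -> sgen d (map fst ps) h.
Proof.
case=> _ D1 D2 hD HY h; move: {2}(size _) (leqnn (size (phi h))) => m.
have iX := sgen_ideal d (map fst ps).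
elim: m h => [|m IHm] h szh Xh.
  move: szh; rewrite leqn0 size_poly_eq0 gr_eq0 => /eqP ->; exact: ideal0 iX.
have [->|h0] := eqVneq h 0; first exact: ideal0 iX.
have /D2[|N [x [Xx szx]]] : sgen d (map snd ps) (lead_coef (phi h)) => //.
  apply: HY => i; have [->|D0] := eqVneq (D i) 0.
    by rewrite mul0r; apply: ideal0 (sgen_ideal _ _).
  have [w hw] := hD i; have [_ {1}<-] := lead_form_top (hom_lead hw) D0.
  by rewrite -lead_coefM -rmorphM; apply: D1.
apply: (@sgen_sat _ _ _ N); apply: (idealBK iX Xx); apply: IHm => [|i].
  by rewrite -ltnS; apply: leq_trans szh.
rewrite mulrBr mulrCA; apply: idealB => //; apply: ideal_mull => //.
Qed.

End Initial.

End GradingTheory.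

(** * Koszul relations *)

Section Relations.

Variable R : comNzRingType.
Implicit Types (s f : seq R) (u g : R).

Definition rowseq s : 'rV[R]_(size s) := \row_i s`_i.

(* Linear relations between the entries of f of Koszul type; the antisymmetric
   matrix is written b - b^T so that its diagonal vanishes in any characteristic. *)
Definition koszul m (f : 'rV[R]_m) (c : 'cV[R]_m) : Prop :=
  exists b : 'M[R]_m, c = (b - b^T) *m f^T.

Definition koszul_exact m (f : 'rV[R]_m) : Prop :=
  forall c, f *m c = 0 -> koszul f c.

Lemma koszul0 m (f : 'rV[R]_m) : koszul f 0.
Proof. by exists 0; rewrite trmx0 subrr mul0mx. Qed.

Lemma koszulD m (f : 'rV[R]_m) c c' :
  koszul f c -> koszul f c' -> koszul f (c + c').
Proof.
case=> b -> [b' ->]; exists (b + b').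
by rewrite -mulmxDl linearD /= opprD addrACA.
Qed.

Lemma koszulZ m (f : 'rV[R]_m) a c : koszul f c -> koszul f (a *: c).
Proof.
by case=> b ->; exists (a *: b); rewrite linearZ /= -scalerBr scalemxAl.
Qed.

Lemma idl_rowseq s p : idl s p <-> exists c : 'cV_(size s), p = (rowseq s *m c) 0 0.
Proof.
rewrite -idlP /ideal_gen inE; split=> [/asboolP[c ->]|[c ->]].
  exists (\col_i c i); rewrite mxE; apply: eq_bigr => i _.
  by rewrite !mxE mulrC.
apply/asboolP; exists (c^~ 0); rewrite mxE; apply: eq_bigr => i _.
by rewrite !mxE mulrC.
Qed.

Lemma rowseq_cons u s : rowseq (u :: s) = row_mx u%:M (rowseq s) :> 'rV_(1 + size s).
Proof.
apply/rowP => i; rewrite !mxE; case: splitP => j ij; rewrite !mxE ij //.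
by rewrite !ord1 eqxx.
Qed.

(** Write the antisymmetric matrix in blocks: its 1 by 1 diagonal block vanishes, and the rest of
    its first row is the transpose of [d]. *)
Lemma koszul_row_mx m u (f : 'rV_m) (a : 'M_1) (c : 'cV_m) :
  koszul (row_mx u%:M f) (col_mx a c) <->
  exists2 d, a = f *m d & koszul f (c + u *: d).
Proof.
split=> [[b]|[d -> [B cE]]].
  rewrite -[b]submxK; set b11 := ulsubmx b; set b12 := ursubmx b.
  set b21 := dlsubmx b; set b22 := drsubmx b.
  rewrite tr_block_mx opp_block_mx add_block_mx tr_row_mx mul_block_col.
  case/eq_col_mx; rewrite tr_scalar_mx !mul_mx_scalar.
  have -> : b11 - b11^T = 0 by apply/matrixP => i j; rewrite !ord1 !mxE subrr.
  rewrite scaler0 add0r => aE cE; exists (b12^T - b21).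
    have -> : a = a^T by apply/matrixP => i j; rewrite !ord1 mxE.
    by rewrite aE trmx_mul trmxK linearB /= trmxK.
  by exists b22; rewrite cE addrAC -scalerDr addrA subrK subrr scaler0 add0r.
exists (block_mx 0 d^T 0 B).
rewrite tr_block_mx opp_block_mx add_block_mx !trmx0 trmxK tr_row_mx.
rewrite subr0 subr0 sub0r mul_block_col mul0mx add0r -trmx_mul -cE.
rewrite tr_scalar_mx mul_mx_scalar scalerN addrC addrK; congr col_mx.
by apply/matrixP => i j; rewrite !ord1 !mxE.
Qed.

Lemma koszul_exact_row_mx m u (f : 'rV_m) :
    (forall g : 'M_1, (exists c, u *: g = f *m c) -> exists c, g = f *m c) ->
  koszul_exact f -> koszul_exact (row_mx u%:M f).
Proof.
move=> zu Kf c; rewrite -[c]vsubmxK; set a := usubmx c; set c' := dsubmx c.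
rewrite mul_row_col mul_scalar_mx => /eqP; rewrite addr_eq0 -mulmxN => /eqP e.
have [|d aE] := zu a; first by exists (- c').
apply/koszul_row_mx; exists d => //; apply: Kf.
by rewrite mulmxDr -scalemxAr -aE e mulmxN subrr.
Qed.

Lemma koszul_exact_cons u s :
  nzd (idl s) u -> koszul_exact (rowseq s) -> koszul_exact (rowseq (u :: s)).
Proof.
move=> zu Ks; rewrite rowseq_cons; apply: koszul_exact_row_mx => // g [c e].
have /zu/idl_rowseq[d gd] : idl s (u * g 0 0).
  by apply/idl_rowseq; exists c; rewrite -e mxE.
by exists d; apply/matrixP => i j; rewrite !ord1.
Qed.

Lemma koszul_exact_regular s : regular_sequence s -> koszul_exact (rowseq (rev s)).
Proof.
case=> _; elim/last_ind: s => [|s u IHs] Hs.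
  by move=> c _; exists 0; apply/colP => - [].
rewrite rev_rcons; apply: koszul_exact_cons => [g|].
  have := Hs (size s); rewrite size_rcons ltnSn nth_rcons ltnn eqxx.
  rewrite -cats1 take_size_cat // => /(_ isT) {}Hs gs.
  suff /idlP/Hs/idlP : idl s (u * g).
    by apply: idl_subset => x; rewrite mem_rev.
  by apply: idl_subset gs => x; rewrite mem_rev.
apply: IHs => i lti g; have := Hs i; rewrite size_rcons ltnW // nth_rcons lti.
by rewrite -cats1 takel_cat ?(ltnW lti) // => /(_ isT); apply.
Qed.

(** Writing [u * g] as a combination [c] of [s] gives the relation [(g, - c)]; as it is Koszul, its
    head [g] lies in the ideal of [s]. *)
Lemma koszul_exact_nzd u s : koszul_exact (rowseq (u :: s)) -> nzd (idl s) u.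
Proof.
rewrite rowseq_cons => Kus g /idl_rowseq[c gc].
have Ks : koszul_exact (row_mx u%:M (rowseq s)) by exact: Kus.
have /koszul_row_mx[d gd _] : koszul (row_mx u%:M (rowseq s)) (col_mx g%:M (- c)).
  apply: Ks; rewrite mul_row_col -scalar_mxM mulmxN; apply/matrixP => i j.
  by rewrite !ord1 [LHS]mxE [X in _ + X]mxE -gc !mxE eqxx subrr.
by apply/idl_rowseq; exists d; rewrite -gd mxE eqxx mulr1n.
Qed.

End Relations.

Section GradedRelations.

Variables (P : idomainType) (phi : grading P) (k : nat).
Hypothesis k_gt0 : (0 < k)%N.

Definition order_geq N (p : P) := forall j, (j < N)%N -> (phi p)`_j = 0.

Lemma order_geqM N p q : order_geq 1 p -> order_geq N q -> order_geq N.+1 (p * q).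
Proof.
move=> op oq j jN; rewrite rmorphM coefM big1 // => -[[|i] /= ij] _.
  by rewrite op // mul0r.
by rewrite oq ?mulr0 // ltn_subLR // (leq_trans jN) // addSn ltnS leq_addl.
Qed.

Lemma order_geq_sum N (T : Type) (r : seq T) (F : T -> P) :
  (forall i, order_geq N (F i)) -> order_geq N (\sum_(i <- r) F i).
Proof.
move=> oF j jN; rewrite rmorph_sum coef_sum big1 // => i _.
exact: oF.
Qed.

Let shift D p := if (D < k)%N then 0 else (phi p)`_(D - k).

Let coef_shift D p f : ishom phi k f -> (phi (p * f))`_D = shift D p * f.
Proof.
move=> hf; rewrite rmorphM /= hf mulrA coefMXn coefMC /shift.
by case: ifP; rewrite ?mul0r.
Qed.

Let shiftB D p q : shift D (p - q) = shift D p - shift D q.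
Proof. by rewrite /shift; case: ifP; rewrite ?subr0 // rmorphB coefB. Qed.

(** As [f] is homogeneous, the weight [D] part of a Koszul relation is Koszul, its matrix being the
    weight [D - k] part. Each of the finitely many components of [c] is such a part of a relation
    that agrees with [c] far enough. *)
Lemma koszul_graded m (f : 'rV[P]_m) (c : 'cV[P]_m) :
    (forall i, ishom phi k (f 0 i)) ->
    (forall N, exists2 t, koszul f t & forall i, order_geq N ((c - t) i 0)) ->
  koszul f c.
Proof.
move=> hf Hc; set M := (\max_i size (phi (c i 0)%R))%N.
have -> : c = \sum_(D < M) \col_i (phi (c i 0))`_D.
  apply/colP => i; rewrite summxE -[LHS](gr_horner1 phi).
  rewrite (@horner_coef_wide _ M); last exact: (leq_bigmax i).
  by apply: eq_bigr => j _; rewrite expr1n mulr1 mxE.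
apply: (big_ind (koszul f)); [exact: koszul0 | exact: koszulD |] => D _.
have [t [b tE] ot] := Hc D.+1; exists (map_mx (shift D) b).
apply/colP => i; rewrite mxE.
have := ot i D (ltnSn D); rewrite !mxE rmorphB coefB => /eqP.
rewrite subr_eq0 => /eqP ->; rewrite tE mxE rmorph_sum coef_sum.
apply: eq_bigr => j _; rewrite coef_shift ?mxE ?hf //.
by rewrite shiftB.
Qed.

(** A relation of [s], extended by 0, is Koszul, so it is a Koszul relation of [s] plus [u] times
    another relation. Iterating leaves a remainder divisible by [u ^+ N], of order at least [N], and
    [koszul_graded] concludes. *)
Lemma koszul_exact_behead u s :
    ishom phi k u -> (forall v, v \in s -> ishom phi k v) ->
  koszul_exact (rowseq (u :: s)) -> koszul_exact (rowseq s).
Proof.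
move=> hu hs; rewrite rowseq_cons => Kus.
have Ks : koszul_exact (row_mx u%:M (rowseq s)) by exact: Kus.
have step c : rowseq s *m c = 0 ->
    exists t d, [/\ koszul (rowseq s) t, rowseq s *m d = 0 & c = t + u *: d].
  move=> cs; have /koszul_row_mx[d ds Kt] :
      koszul (row_mx u%:M (rowseq s)) (col_mx 0 c).
    by apply: Ks; rewrite mul_row_col mulmx0 add0r.
  exists (c + u *: d), (- d); split=> //; first by rewrite mulmxN -ds oppr0.
  by rewrite scalerN addrK.
move=> c cs; apply: koszul_graded => [i|N]; first by rewrite mxE; apply/hs/mem_nth.
suff [t [d [Kt ds cE]]] : exists t d,
    [/\ koszul (rowseq s) t, rowseq s *m d = 0 & c = t + u ^+ N *: d].
  exists t => // i; rewrite cE addrC addKr mxE.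
  elim: N {cE} => [|N IHN]; first by move=> j.
  rewrite exprS -mulrA; apply: order_geqM => // j; rewrite ltnS leqn0 => /eqP ->.
  by rewrite hu coefMXn k_gt0.
elim: N => [|N [t [d [Kt ds ->]]]].
  by exists 0, c; split=> //; [apply: koszul0 | rewrite add0r scale1r].
have [t' [d' [Kt' ds' ->]]] := step d ds.
exists (t + u ^+ N *: t'), d'; split=> //; first by apply: koszulD => //; apply: koszulZ.
by rewrite scalerDr addrA scalerA -exprSr.
Qed.

(* With s = f V, f = s U and W = V U, every relation c of f satisfies W c in Koszul,
   while 1 - W has entries of positive degree: iterate c |-> (1 - W) c. *)
Lemma koszul_exact_generators s f :
    koszul_exact (rowseq s) -> (forall p, idl s p <-> idl f p) ->
    (forall v, v \in f -> ishom phi k v) ->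
    (forall c : 'cV_(size f), (forall i, ishom phi 0 (c i 0)) -> rowseq f *m c = 0 -> c = 0) ->
  koszul_exact (rowseq f).
Proof.
move=> Ks eqsf hf indf.
have expand (a b : seq P) : (forall u, u \in a -> idl b u) ->
    exists V, rowseq a = rowseq b *m V.
  move=> ab; have HV (i : 'I_(size a)) : exists c : 'cV_(size b),
      a`_i = (rowseq b *m c) 0 0.
    by apply/idl_rowseq/ab/mem_nth.
  have [V {}HV] := choice HV.
  exists (\matrix_(i, j) V j i 0); apply/rowP => i; rewrite mxE HV !mxE.
  by apply: eq_bigr => j _; rewrite !mxE.
have [V sV] : exists V, rowseq s = rowseq f *m V.
  by apply: expand => u us; apply/eqsf/idl_mem.
have [U fU] : exists U, rowseq f = rowseq s *m U.
  by apply: expand => u us; apply/eqsf/idl_mem.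
pose W := V *m U; have fW : rowseq f *m W = rowseq f by rewrite mulmxA -sV -fU.
have KW c : rowseq f *m c = 0 -> koszul (rowseq f) (W *m c).
  move=> cf; have [|b UcE] := Ks (U *m c); first by rewrite mulmxA -fU.
  exists (V *m b *m V^T); rewrite /W -(mulmxA V U c) UcE sV trmx_mul.
  by rewrite !trmx_mul trmxK !mulmxA -!mulmxBl -mulmxBr.
have oW i j : order_geq 1 ((1%:M - W) i j).
  (* The weight [k] part of [f (1 - W) = 0] is a relation between the entries of [f] with
     coefficients of weight 0. *)
  have : (\col_i (phi ((1%:M - W) i j))`_0) = 0 :> 'cV_(size f).
    apply: indf => [l|]; first by rewrite mxE; apply: hom_coef.
    apply/matrixP => a b; rewrite !ord1 {a b}.
    have : ((rowseq f *m (1%:M - W)) 0 j) = 0.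
      by rewrite mulmxBr mulmx1 fW subrr mxE.
    rewrite !mxE => /(congr1 phi)/(congr1 (fun q : {poly P} => q`_k)).
    rewrite rmorph_sum coef_sum rmorph0 coef0 => e; rewrite -[RHS]e.
    apply: eq_bigr => l _; rewrite !mxE [in RHS]mulrC coef_shift; last exact/hf/mem_nth.
    by rewrite /shift ltnn subnn mulrC.
  by move=> /colP/(_ i); rewrite !mxE => e l; rewrite ltnS leqn0 => /eqP ->.
move=> c cf; apply: koszul_graded => [i|N]; first by rewrite mxE; apply/hf/mem_nth.
suff [t [Kt cts oN]] : exists t, [/\ koszul (rowseq f) t,
    rowseq f *m (c - t) = 0 & forall i, order_geq N ((c - t) i 0)] by exists t.
elim: N => [|N [t [Kt cts oN]]].
  by exists 0; split=> //; [apply: koszul0 | rewrite subr0].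
exists (t + W *m (c - t)); split; first by apply: koszulD => //; apply: KW.
  by rewrite opprD addrA mulmxBr mulmxA fW subrr.
move=> i; rewrite opprD addrA -{1}[c - t]mul1mx -mulmxBl mxE.
by apply: order_geq_sum => j; apply: order_geqM.
Qed.

End GradedRelations.

(** * Annihilators of minors *)

Lemma regseq_sat (P : idomainType) (d : P) s : regseq 1 s -> regseq d s.
Proof.
elim: s => //= u s IHs [zu /IHs rs]; split=> //.
by apply: nzd_sgen => g /sgen1/zu/sgen1.
Qed.

(** Multiplying by a block triangular matrix of determinant [d ^+ n], built from the adjugate, gives
    a block triangular matrix whose determinant is [d ^+ n] times the right-hand side; cancel
    [d ^+ n]. *)
Lemma det_bordered (P : idomainType) n (a : 'M[P]_1) (v : 'rV_n) (u : 'cV_n) (M : 'M_n) :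
  \det M != 0 ->
  \det (block_mx a v u M) = \det M * a 0 0 - (v *m \adj M *m u) 0 0.
Proof.
move=> M0; set d := \det M.
have e : block_mx a v u M *m block_mx d%:M 0 (- (\adj M *m u)) (\adj M) =
    block_mx (d *: a - v *m \adj M *m u) (v *m \adj M) 0 d%:M.
  rewrite mulmx_block !mulmxN !mulmx0 !add0r !mul_mx_scalar !mulmxA.
  by rewrite mul_mx_adj mul_scalar_mx subrr.
have := congr1 determinant e.
rewrite det_mulmx det_lblock det_ublock !det_scalar expr1 [in RHS]det_mx11.
have adjd : d * \det (\adj M) = d ^+ n by rewrite -det_mulmx mul_mx_adj det_scalar.
rewrite adjd => /(mulIf (expf_neq0 n M0)) ->.
by rewrite !mxE.
Qed.

Section Minors.

Variables (P : idomainType) (t c : nat) (G : 'M[P]_(t, c)).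

Definition minor s (r : {ffun 'I_s -> 'I_t}) (q : {ffun 'I_s -> 'I_c}) : P :=
  \det (mxsub r q G).

Definition ffun_cons (T : Type) s (a : T) (r : {ffun 'I_s -> T}) : {ffun 'I_s.+1 -> T} :=
  [ffun i => if unlift ord0 i is Some j then r j else a].

(* The minor (r, q) of G bordered by the row e and by the column u, which need not be
   a column of G, in Schur complement form. *)
Definition bordered s (r : {ffun 'I_s -> 'I_t}) (q : {ffun 'I_s -> 'I_c})
    (e : 'I_t) (u : 'cV[P]_t) : P :=
  minor r q * u e 0
  - (row e (colsub q G) *m \adj (mxsub r q G) *m rowsub r u) 0 0.

Section Bordered.

Variables (s : nat) (r : {ffun 'I_s -> 'I_t}) (q : {ffun 'I_s -> 'I_c}).

Let d := minor r q.
Let beta := bordered r q.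

Lemma borderedD e u v : beta e (u + v) = beta e u + beta e v.
Proof.
rewrite /beta /bordered; have -> : rowsub r (u + v) = rowsub r u + rowsub r v.
  by apply/matrixP => i j; rewrite !mxE.
by rewrite mulmxDr [X in _ * X - _]mxE [X in _ - X = _]mxE; ring.
Qed.

Lemma borderedZ e a u : beta e (a *: u) = a * beta e u.
Proof.
rewrite /beta /bordered; have -> : rowsub r (a *: u) = a *: rowsub r u.
  by apply/matrixP => i j; rewrite !mxE.
by rewrite -scalemxAr [X in _ * X - _]mxE [X in _ - X = _]mxE; ring.
Qed.

Lemma bordered0 e : beta e 0 = 0.
Proof. by rewrite -(scale0r 0) borderedZ mul0r. Qed.

Lemma bordered_mul e (y : 'cV_c) : beta e (G *m y) = \sum_j y j 0 * beta e (col j G).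
Proof.
have -> : G *m y = \sum_j y j 0 *: col j G.
  apply/colP => i; rewrite summxE mxE; apply: eq_bigr => j _.
  by rewrite !mxE mulrC.
elim/big_rec2: _ => [|j a b _ <-]; first by rewrite bordered0.
by rewrite borderedD borderedZ.
Qed.

(** With [bordered_mul], the bordered value of [G *m y] thus lies in the ideal of the minors of size
    [s.+1]. *)
Lemma bordered_col e j : d != 0 ->
  beta e (col j G) = minor (ffun_cons e r) (ffun_cons j q).
Proof.
move=> d0; rewrite /beta /bordered.
have -> : col j G e 0 = ((G e j)%:M : 'M_1) 0 0 by rewrite !mxE eqxx.
rewrite -det_bordered //; congr (\det _).
apply/matrixP => a b; rewrite [RHS]mxE !ffunE.
case: (unliftP (ord0 : 'I_(1 + s)) a) => [a' ->|->];
case: (unliftP (ord0 : 'I_(1 + s)) b) => [b' ->|->];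
rewrite ?liftK ?unlift_none.
- by rewrite -!rshift1 block_mxEdr mxE.
- by rewrite -rshift1 -[ord0](lshift0 s 0) block_mxEdl !mxE.
- by rewrite -rshift1 -[ord0](lshift0 s 0) block_mxEur !mxE.
- by rewrite -[ord0](lshift0 s 0) block_mxEul !mxE eqxx.
Qed.

(** The difference involves only the entries of [u] in the rows of the minor; once [d] is inverted,
    the bordered value can replace [u e 0] as a generator. *)
Lemma bordered_idl e (u : 'cV_t) : idl [seq u (r i) 0 | i <- enum 'I_s] (d * u e 0 - beta e u).
Proof.
rewrite /beta /bordered opprB addrC subrK mxE.
apply: ideal_sum; first exact: idl_ideal.
move=> i _; apply: ideal_mull; first exact: idl_ideal.
rewrite mxE; apply: idl_mem; apply: (map_f (fun i => u (r i) 0)).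
by rewrite mem_enum.
Qed.

Lemma minor_inj : d != 0 -> injective r.
Proof.
move=> d0 i j eqr; apply: contraNeq d0 => neq_ij; apply/eqP.
by apply: (determinant_alternate neq_ij) => k; rewrite !mxE eqr.
Qed.

Lemma minor_hom (phi : grading P) :
  (forall i j, ishom phi 0 (G i j)) -> ishom phi 0 d.
Proof.
by move=> hG; rewrite -(muln0 s); apply: hom_det => i j; rewrite mxE.
Qed.

Let border_coef_hom (phi : grading P) e i : (forall i j, ishom phi 0 (G i j)) ->
  ishom phi 0 ((row e (colsub q G) *m \adj (mxsub r q G)) 0 i).
Proof.
move=> hG; rewrite mxE; apply: hom_sum => j _; apply: hom0M; first by rewrite !mxE.
rewrite mxE; apply: hom0M.
  by have := homX (i + j) (homN (hom1 phi)); rewrite muln0.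
by rewrite /cofactor -(muln0 s.-1); apply: hom_det => a b; rewrite !mxE.
Qed.

Lemma bordered_hom (phi : grading P) w e (u : 'cV_t) :
    (forall i j, ishom phi 0 (G i j)) -> (forall i, ishom phi w (u i 0)) ->
  ishom phi w (beta e u).
Proof.
move=> hG hu; apply: homB; first by apply: hom0M => //; apply: minor_hom.
rewrite mxE; apply: hom_sum => i _; apply: hom0M; first exact: border_coef_hom.
by rewrite mxE.
Qed.

Lemma bordered_size (phi : grading P) w e (u : 'cV_t) :
    (forall i j, ishom phi 0 (G i j)) ->
    (forall i, (size (phi (u i 0)%R) <= w)%N) ->
  (size (phi (beta e u)) <= w)%N.
Proof.
move=> hG hu; apply: size_grD; first by apply: size_homM => //; apply: minor_hom.
apply/size_grN; rewrite mxE; apply: size_gr_sum => i _.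
by apply: size_homM; [apply: border_coef_hom | rewrite mxE].
Qed.

Lemma bordered_lead (phi : grading P) w e (u : 'cV_t) :
    (forall i j, ishom phi 0 (G i j)) -> ishom phi w (u e 0) ->
    (forall i, (size (phi (u (r i) 0)%R) <= w)%N) ->
  lead_form phi w (d * u e 0) (beta e u).
Proof.
move=> hG hue hu; split; first by apply: hom0M => //; apply: minor_hom.
rewrite /beta /bordered addrAC subrr add0r; apply/size_grN.
rewrite mxE; apply: size_gr_sum => i _.
by apply: size_homM; [apply: border_coef_hom | rewrite mxE].
Qed.

End Bordered.

(** * Descent on the size of the minors *)

Section Descent.

Variables (y : 'cV[P]_c) (Z : 'cV[P]_t) (w : P) (s0 : seq P) (k : nat).

Let l : 'cV[P]_t := G *m y.
Let x : 'cV[P]_t := l + w *: Z.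
Definition gens (u : 'cV[P]_t) (F : seq 'I_t) := [seq u i 0 | i <- F].

Hypothesis l_nzd : forall e F, uniq (e :: F) -> nzd (idl (gens l F ++ s0)) (l e 0).
Hypothesis s0_reg : regseq 1 s0.

Lemma regseq_gens d F : uniq F -> regseq d (gens l F ++ s0).
Proof.
elim: F => [|e F IHF] uF; first exact: regseq_sat.
split; first exact: nzd_sgen (l_nzd uF).
by apply: IHF; case/andP: uF.
Qed.

(** In such a grading [l] has weight [k] and [w Z] only smaller weights, as size at most [k] means
    weights below [k]; hence [l] consists of the leading forms of [x]. *)
Definition compatible (phi : grading P) : Prop :=
  [/\ forall u, u \in s0 -> ishom phi 0 u,
      forall i j, ishom phi 0 (G i j),
      forall j, ishom phi k (y j 0),
      ishom phi 0 w &
      forall i, (size (phi (Z i 0)%R) <= k)%N].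

Lemma perturbation_initial phi F : compatible phi -> uniq F ->
  initial phi 1 ([seq (x i 0, l i 0) | i <- F] ++ [seq (u, u) | u <- s0]).
Proof.
case=> hs0 hG hy hw hZ uF; apply: initial_regseq; [exact: hom1 | exact: oner_neq0 | |].
  move=> p; rewrite mem_cat => /orP[/mapP[i _ ->]|/mapP[u us ->]].
    exists k; split=> /=.
      by rewrite mxE; apply: hom_sum => j _; apply: hom0M.
    by rewrite !mxE addrAC subrr add0r; apply: size_homM.
  by exists 0%N; apply/hom_lead/hs0.
rewrite map_cat -!map_comp (@eq_map _ _ _ id) // map_id.
exact: regseq_gens.
Qed.

Lemma perturbation_fst F :
  map fst ([seq (x i 0, l i 0) | i <- F] ++ [seq (u, u) | u <- s0]) = gens x F ++ s0.
Proof. by rewrite map_cat -!map_comp [X in _ ++ X](@eq_map _ _ _ id) ?map_id. Qed.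

Lemma perturbation_snd F :
  map snd ([seq (x i 0, l i 0) | i <- F] ++ [seq (u, u) | u <- s0]) = gens l F ++ s0.
Proof. by rewrite map_cat -!map_comp [X in _ ++ X](@eq_map _ _ _ id) ?map_id. Qed.

Lemma perturbation_nzd phi F v : compatible phi -> uniq F -> ishom phi 0 v ->
  nzd (idl (gens l F ++ s0)) v -> nzd (idl (gens x F ++ s0)) v.
Proof.
move=> cp uF hv zv; apply: eq_nzd (@sgen1 _ _) _; rewrite -perturbation_fst.
apply: (nzd_initial (perturbation_initial cp uF) (hom_lead hv)).
by rewrite perturbation_snd => h /sgen1/zv/sgen1.
Qed.

Lemma perturbation_reg phi F : compatible phi -> uniq F -> regseq 1 (gens x F ++ s0).
Proof.
move=> cp; elim: F => [|e F IHF] uF; first by [].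
have uF' : uniq F by case/andP: uF.
split; last exact: IHF.
have [hs0 hG hy hw hZ] := cp.
rewrite -[X in nzd (sgen 1 X)]/(gens x F ++ s0) -perturbation_fst.
apply: (nzd_initial (F := l e 0) (w := k)
  (perturbation_initial cp uF')).
  split; first by rewrite mxE; apply: hom_sum => j _; apply: hom0M.
  by rewrite !mxE addrAC subrr add0r; apply: size_homM.
by rewrite perturbation_snd; apply/nzd_sgen/l_nzd.
Qed.

Hypothesis Z_nzd : forall e, nzd (idl (gens l (enum 'I_t) ++ s0)) (Z e 0).
Hypothesis w_nzd : nzd (idl (gens x (enum 'I_t) ++ s0)) w.
(** A grading in which [Z e0 0] dominates the other entries of [Z] makes [d * Z e0 0] the leading
    form of the bordered value of [Z] in row [e0]. *)
Hypothesis separating : forall e0, exists (phi : grading P) k0,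
  [/\ compatible phi, ishom phi k0 (Z e0 0) &
      forall e, e != e0 -> (size (phi (Z e 0)%R) <= k0)%N].

Let X := idl (gens x (enum 'I_t) ++ s0).

Section Step.

Variables (s : nat) (r : {ffun 'I_s -> 'I_t}) (q : {ffun 'I_s -> 'I_c}).
Hypotheses (lt_s_t : (s < t)%N) (d_neq0 : minor r q != 0).

Let d := minor r q.
Let A := [seq r i | i <- enum 'I_s].
Let B := [seq i <- enum 'I_t | i \notin A].
(** [lam' e], [zeta e] and [lam e] are the b'_e, c_e and b'_e + z_v c_e of the overview. *)
Let lam' e := bordered r q e l.
Let zeta e := bordered r q e Z.
Let lam e := bordered r q e x.

Let lamE e : lam e = lam' e + w * zeta e.
Proof. by rewrite /lam /x borderedD borderedZ. Qed.

Let uniqA : uniq A.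
Proof. by rewrite map_inj_uniq ?enum_uniq //; apply: minor_inj d_neq0. Qed.

Let bordered_mod e (u : 'cV_t) s1 :
  idl (gens u A ++ s1) (d * u e 0 - bordered r q e u).
Proof.
apply: idl_subset (bordered_idl r q e u) => v.
by rewrite mem_cat /gens /A -map_comp => ->.
Qed.

(** A stage of the exchange: the rows of [F1] still carry [lam], those of [F2] already [lam']. The
    leading forms depend only on the rows in [F1 ++ F2]. *)
Let mix F1 F2 : seq (P * P) :=
  [seq (lam i, lam' i) | i <- F1] ++ [seq (lam' i, lam' i) | i <- F2]
  ++ [seq (x i 0, l i 0) | i <- A] ++ [seq (u, u) | u <- s0].

Let mix_fst F1 F2 : map fst (mix F1 F2) =
  map lam F1 ++ map lam' F2 ++ gens x A ++ s0.
Proof. by rewrite 2!map_cat perturbation_fst -!map_comp. Qed.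

Let mix_snd F1 F2 : map snd (mix F1 F2) = map lam' (F1 ++ F2) ++ gens l A ++ s0.
Proof.
by rewrite /mix map_cat [X in _ ++ X]map_cat perturbation_snd -!map_comp map_cat -catA.
Qed.

(** Modulo the [l] of the rows in [A], [lam' i] is [d * l i 0], and saturation makes [d]
    harmless. *)
Let sgen_lam F p :
  sgen d (map lam' F ++ gens l A ++ s0) p <-> sgen d (gens l (F ++ A) ++ s0) p.
Proof.
split; apply: sgen_sub => v; rewrite !mem_cat.
- rewrite /gens map_cat; case/orP => [/mapP[i iF ->]|]; last first.
    move=> vA; apply: sgen_mem; rewrite !mem_cat.
    by case/orP: vA => ->; rewrite ?orbT.
  have := bordered_mod i l s0 => /(idealN (idl_ideal _)); rewrite opprB => h.
  apply: (idealBK (sgen_ideal _ _) (q := d * l i 0)).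
    apply: (ideal_mull (sgen_ideal _ _)); apply: sgen_mem.
    by rewrite !mem_cat (map_f (fun i => l i 0) iF).
  apply: sgen_idl; apply: idl_subset h => z; rewrite !mem_cat.
  by case/orP => ->; rewrite ?orbT.
- rewrite /gens map_cat mem_cat -orbA; case/orP => [/mapP[i iF ->]|]; last first.
    by move=> vA; apply: sgen_mem; rewrite !mem_cat vA orbT.
  apply: sgen_sat1; apply: (idealBK (sgen_ideal _ _) (q := lam' i)).
    by apply: sgen_mem; rewrite mem_cat map_f.
  apply: sgen_idl; apply: idl_subset (bordered_mod i l s0) => z.
  by move=> zs; rewrite mem_cat zs orbT.
Qed.

Let lam_nzd e F : uniq (e :: F) -> (forall i, i \in e :: F -> i \notin A) ->
  nzd (sgen d (map lam' F ++ gens l A ++ s0)) (lam' e).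
Proof.
move=> uF FA; apply: (nzd_mod (u := d * l e 0)); first exact: sgen_ideal.
  apply: sgen_idl; apply: idl_subset (bordered_mod e l s0) => z.
  by move=> zs; rewrite mem_cat zs orbT.
apply: nzdM => [g /sgen_sat1 //|].
apply: eq_nzd (fun p => iff_sym (sgen_lam F p)) _.
apply/nzd_sgen/l_nzd; rewrite /= mem_cat negb_or cat_uniq uniqA andbT.
have [eF uF'] : e \notin F /\ uniq F by apply/andP.
rewrite eF uF' FA ?mem_head //=.
by apply/hasPn => i iA; apply: contraL iA => iF; rewrite FA // inE iF orbT.
Qed.

Let mix_initial phi F1 F2 : compatible phi ->
    uniq (F1 ++ F2) -> (forall i, i \in F1 ++ F2 -> i \notin A) ->
  initial phi d (mix F1 F2).
Proof.
case=> hs0 hG hy hw hZ uF FA.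
have hl i : ishom phi k (l i 0) by rewrite mxE; apply: hom_sum => j _; apply: hom0M.
apply: initial_regseq => //; first exact: minor_hom.
  move=> p; rewrite !mem_cat.
  case/or4P=> [/mapP[i _ ->]|/mapP[i _ ->]|/mapP[i _ ->]|/mapP[u us ->]].
  - exists k; split; first exact: bordered_hom.
    by rewrite lamE addrAC subrr add0r; apply: size_homM => //; apply: bordered_size.
  - by exists k; apply/hom_lead/bordered_hom.
  - by exists k; split=> //=; rewrite !mxE addrAC subrr add0r; apply: size_homM.
  - by exists 0%N; apply/hom_lead/hs0.
rewrite mix_snd; elim: (F1 ++ F2) uF FA => [|e F IHF] uF FA.
  exact: regseq_gens.
split; first exact: lam_nzd.
by apply: IHF => [|i iF]; [case/andP: uF | apply: FA; rewrite inE iF orbT].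
Qed.

Let mix_lead_nzd phi F1 F2 : compatible phi ->
    uniq (F1 ++ F2) -> (forall i, i \in F1 ++ F2 -> i \notin A) ->
  forall v w0 V, lead_form phi w0 V v -> nzd (sgen d (map lam' (F1 ++ F2) ++ gens l A ++ s0)) V ->
  nzd (sgen d (map fst (mix F1 F2))) v.
Proof.
move=> cp uF FA v w0 V lV zV.
have hd : ishom phi 0 d by case: cp => _ hG _ _ _; apply: minor_hom.
by apply: (nzd_initial (mix_initial cp uF FA) lV); rewrite mix_snd.
Qed.

Let mem_B i : (i \in B) = (i \notin A).
Proof. by rewrite mem_filter mem_enum andbT. Qed.

Lemma minor_power h :
    (forall (r' : {ffun 'I_s.+1 -> 'I_t}) q', X (minor r' q' * h)) ->
  exists N, X (minor r q ^+ N * h).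
Proof.
move=> Xh; have iX : ideal X := idl_ideal _.
(* A row outside the minor exists because [s < t]; its [zeta] will be the final nonzerodivisor. *)
have [e0 e0A] : exists e0, e0 \notin A.
  apply/existsP; rewrite -negb_forall; apply: contraL lt_s_t => /forallP allA.
  have sub : {subset enum 'I_t <= A} by move=> i _; apply: allA.
  have le_t_A : (size (enum 'I_t) <= size A)%N by apply: uniq_leq_size; rewrite ?enum_uniq.
  by rewrite -leqNgt -(size_enum_ord t) (leq_trans le_t_A) // size_map size_enum_ord.
have [phi [k0 [cp hZ0 hZ]]] := separating e0.
have [hs0 hG hy hw hZk] := cp.
(* Multipliers that kill [h]: those brought in by the exchange, and the one that ends it. *)
pose J a := (exists2 i, i \in B & a = lam' i) \/ a = zeta e0.
have Xlam' i : X (lam' i * h).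
  rewrite /lam' /l bordered_mul mulr_suml; apply: ideal_sum => // j _.
  by rewrite bordered_col // -mulrA; apply: ideal_mull.
have sub_all F u : {subset gens u F ++ s0 <= gens u (enum 'I_t) ++ s0}.
  move=> v; rewrite !mem_cat => /orP[/mapP[i _ ->]|->]; last by rewrite orbT.
  by rewrite (map_f (fun i => u i 0)) ?mem_enum.
have Xx i : X (x i 0).
  by apply: idl_mem; rewrite mem_cat (map_f (fun i => x i 0)) ?mem_enum.
have Xlam i : X (lam i).
  have Xd : X (d * x i 0) by apply: ideal_mull.
  rewrite -[lam i](subKr (d * x i 0)); apply: idealB => //.
  exact: (idl_subset (sub_all _ _) (bordered_mod i x s0)).
(* [w * zeta i] is [lam i - lam' i], and [w] can be cancelled. *)
have Xzeta i : X (zeta i * h).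
  apply: w_nzd; rewrite -/X.
  have -> : w * (zeta i * h) = lam i * h - lam' i * h.
    by rewrite lamE; ring.
  by apply: idealB => //; apply: ideal_mulr.
have XJ a : J a -> sgen d (map fst (mix B [::])) (a * h).
  move=> Ja; have Xa : X (a * h) by case: Ja => [[i _ ->]|->].
  apply: sgen_sub (sgen_idl d Xa) => v; rewrite mem_cat mix_fst.
  case/orP => [/mapP[i _ ->]|vs]; last by apply: sgen_mem; rewrite !mem_cat vs !orbT.
  have [iA|iA] := boolP (i \in A).
    by apply: sgen_mem; rewrite !mem_cat (map_f (fun i => x i 0)) ?orbT.
  apply: sgen_sat1; apply: (idealBK (sgen_ideal _ _) (q := lam i)).
    by apply: sgen_mem; rewrite !mem_cat map_f // mem_B.
  apply: sgen_idl; apply: idl_subset (bordered_mod i x s0) => z.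
  by move=> zs; rewrite !mem_cat -mem_cat zs !orbT.
(* Induction on [F1], for every [g] at once: [exchange] moves a row to [F2], and once [F1] is empty
   [zeta e0] is regular. *)
suff H F1 F2 : perm_eq (F1 ++ F2) B -> forall g,
    (forall a, J a -> sgen d (map fst (mix F1 F2)) (a * g)) ->
    sgen d (map fst (mix F1 F2)) g.
  have [|N XN] := H B [::] _ h XJ; first by rewrite cats0.
  exists N; apply: idl_sub XN => // v; rewrite mix_fst !mem_cat.
  case/or4P => [/mapP[i _ ->] //|//|/mapP[i _ ->] //|vs].
  by apply: idl_mem; rewrite mem_cat vs orbT.
elim: F1 F2 => [|e F1 IHF] F2 eqB.
  move=> g /(_ (zeta e0) (or_intror erefl)).
  have uF : uniq ([::] ++ F2) by rewrite (perm_uniq eqB) filter_uniq ?enum_uniq.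
  have FA i : i \in [::] ++ F2 -> i \notin A by rewrite (perm_mem eqB) mem_B.
  apply: (mix_lead_nzd cp uF FA (w0 := k0) (V := d * Z e0 0)).
    apply: bordered_lead => // i; apply: hZ; apply: contraNneq e0A => <-.
    by rewrite map_f ?mem_enum.
  apply: nzdM => [p /sgen_sat1 //|].
  apply: eq_nzd (fun p => iff_sym (sgen_lam _ p)) _.
  apply: eq_nzd (nzd_sgen (d := d) (@Z_nzd e0)) => p.
  split; apply: sgen_subset; last exact: sub_all.
  move=> v; rewrite !mem_cat => /orP[/mapP[i _ ->]|->]; last by rewrite orbT.
  rewrite (map_f (fun i => l i 0)) // mem_cat (perm_mem eqB) mem_B.
  by case: (i \in A).
have uF : uniq (e :: F1 ++ F2) by rewrite -cat_cons (perm_uniq eqB) filter_uniq ?enum_uniq.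
have FA i : i \in e :: F1 ++ F2 -> i \notin A.
  by rewrite -cat_cons (perm_mem eqB) mem_B.
have uF' : uniq (F1 ++ F2) by case/andP: uF.
have FA' i : i \in F1 ++ F2 -> i \notin A by move=> iF; apply: FA; rewrite inE iF orbT.
have zlam' := lam_nzd uF FA.
apply: (exchange (u := lam e) (v := lam' e)).
- apply: (mix_lead_nzd cp uF' FA' (w0 := k) _ zlam'); split.
    by apply: bordered_hom => // i; rewrite mxE; apply: hom_sum => j _; apply: hom0M.
  by rewrite lamE addrAC subrr add0r; apply: size_homM => //; apply: bordered_size.
- apply: (mix_lead_nzd cp uF' FA' (w0 := k) _ zlam'); apply/hom_lead.
  by apply: bordered_hom => // i; rewrite mxE; apply: hom_sum => j _; apply: hom0M.
- by left; exists e => //; rewrite -(perm_mem eqB) mem_head.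
- have eqmix p : sgen d (lam' e :: map fst (mix F1 F2)) p <->
      sgen d (map fst (mix F1 (e :: F2))) p.
    have eqm : lam' e :: map fst (mix F1 F2) =i map fst (mix F1 (e :: F2)).
      by move=> v; rewrite !mix_fst /= !(inE, mem_cat) orbCA -?orbA.
    by split; apply: sgen_subset => v; rewrite eqm.
  move=> g Jg; apply/eqmix; apply: IHF => [|a /Jg/eqmix //].
  by rewrite -cat1s perm_catCA.
Qed.

End Step.

(** To pass from size [s.+1] to [s], [minor_power] gives powers of minors that kill [h], and
    [annihilator_power] reduces them to first powers; the minor of size 0 is 1. *)
Lemma minors_annihilator s : (s <= t)%N -> forall h,
    (forall (r : {ffun 'I_s -> 'I_t}) q, X (minor r q * h)) -> X h.
Proof.
have iX : ideal X := idl_ideal _.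
elim: s => [|s IHs] les h Xh.
  have := Xh (finfun (fun i : 'I_0 => False_rect _ (notF (ltn_ord i))))
    (finfun (fun i : 'I_0 => False_rect _ (notF (ltn_ord i)))).
  by rewrite /minor det_mx00 mul1r.
apply: (annihilator_power (D := fun p : {ffun 'I_s -> 'I_t} * {ffun 'I_s -> 'I_c} =>
  minor p.1 p.2)) => // [g Xg|[r q] /=].
  by apply: IHs (ltnW les) _ _ => r q; apply: (Xg (r, q)).
have [->|d0] := eqVneq (minor r q) 0.
  by exists 1%N; rewrite expr1 mul0r; apply: ideal0.
exact: minor_power.
Qed.

End Descent.

End Minors.

(** * Gradings and columns of the polynomial ring *)

Section Substitution.

Lemma mpoly_rmorph_mod N (K S : comNzRingType) (f g : {rmorphism {mpoly K[N]} -> S})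
    (I : S -> Prop) :
    ideal I -> (forall a, I (f a%:MP - g a%:MP)) -> (forall i, I (f 'X_i - g 'X_i)) ->
  forall p, I (f p - g p).
Proof.
move=> iI fgC fgX.
have fgM p q : I (f p - g p) -> I (f q - g q) -> I (f (p * q) - g (p * q)).
  move=> Ip Iq; rewrite !rmorphM.
  have -> : f p * f q - g p * g q = f p * (f q - g q) + g q * (f p - g p) by ring.
  by apply: idealD => //; apply: ideal_mull.
move=> p; rewrite (mpolyE p) !rmorph_sum /= -sumrB.
apply: ideal_sum => // m _; rewrite -mul_mpolyC; apply: (fgM) => //.
rewrite mpolyXE_id; apply: (big_ind (fun p => I (f p - g p))) => //.
  by rewrite !rmorph1 subrr; apply: ideal0.
move=> i _; elim: (m i) => [|k IHk]; first by rewrite !expr0 !rmorph1 subrr; apply: ideal0.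
by rewrite exprS; apply: (fgM).
Qed.

Lemma mpoly_rmorph_eq N (K S : comNzRingType) (f g : {rmorphism {mpoly K[N]} -> S}) :
    (forall a, f a%:MP = g a%:MP) -> (forall i, f 'X_i = g 'X_i) -> f =1 g.
Proof.
move=> fgC fgX p; apply/subr0_eq; apply: (@mpoly_rmorph_mod _ _ _ f g (fun x => x = 0)).
- by split=> // [_ _ -> ->|a _ ->]; rewrite ?addr0 ?mulr0.
- by move=> a; rewrite fgC subrr.
- by move=> i; rewrite fgX subrr.
Qed.

Variables (K : fieldType) (n d : nat) (S : comNzRingType).

Definition pair_of_index (k : 'I_(n * d)) : 'I_n * 'I_d :=
  enum_val (cast_ord (esym (mxvec_cast n d)) k).

Lemma pair_of_indexK i j : pair_of_index (mxvec_index i j) = (i, j).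
Proof. by rewrite /pair_of_index cast_ordK enum_rankK. Qed.

Definition subst_fun (h : 'I_n -> 'I_d -> S) (k : 'I_(n * d)) : S :=
  h (pair_of_index k).1 (pair_of_index k).2.

Definition subst (f : {rmorphism K -> S}) h : {rmorphism {mpoly K[n * d]} -> S} :=
  mmap f (subst_fun h).

Lemma substC f h a : subst f h a%:MP = f a.
Proof. exact: mmapC. Qed.

Lemma subst_var f h i j : subst f h (lss_var K i j) = h i j.
Proof. by rewrite /subst /= mmapX mmap1U /subst_fun pair_of_indexK. Qed.

Lemma lss_rmorph_mod (f g : {rmorphism {mpoly K[n * d]} -> S}) (I : S -> Prop) :
    ideal I -> (forall a, I (f a%:MP - g a%:MP)) ->
    (forall i j, I (f (lss_var K i j) - g (lss_var K i j))) ->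
  forall p, I (f p - g p).
Proof.
move=> iI fgC fgX; apply: mpoly_rmorph_mod => // k.
by case/mxvec_indexP: k => i j; apply: fgX.
Qed.

Lemma lss_rmorph_eq (f g : {rmorphism {mpoly K[n * d]} -> S}) :
    (forall a, f a%:MP = g a%:MP) ->
    (forall i j, f (lss_var K i j) = g (lss_var K i j)) -> f =1 g.
Proof.
move=> fgC fgX; apply: mpoly_rmorph_eq => // k.
by case/mxvec_indexP: k => i j; apply: fgX.
Qed.

Lemma substitution_exists (f : {rmorphism K -> S}) h :
  exists2 g : {rmorphism {mpoly K[n * d]} -> S},
    forall a, g a%:MP = f a & forall i j, g (lss_var K i j) = h i j.
Proof. by exists (subst f h) => [a|i j]; [apply: substC | apply: subst_var]. Qed.

End Substitution.

Section Weights.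

Variables (K : fieldType) (n d : nat) (wt : 'I_n -> 'I_d -> nat).

Let wt_mor : {rmorphism {mpoly K[n * d]} -> {poly {mpoly K[n * d]}}} :=
  subst (polyC \o mpolyC (n * d) (R:=K))
    (fun i j => (lss_var K i j)%:P * 'X^(wt i j)).

Let wt_horner1 p : (wt_mor p).[1] = p.
Proof.
apply: (@lss_rmorph_eq _ _ _ _ (horner_eval 1 \o wt_mor) idfun) => [a|i j] /=.
  by rewrite substC /horner_eval /= hornerC.
by rewrite subst_var /horner_eval hornerM hornerC hornerXn expr1n mulr1.
Qed.

Let wt_coef p i : wt_mor (wt_mor p)`_i = ((wt_mor p)`_i)%:P * 'X^i.
Proof.
suff H m a : exists w, wt_mor (a *: 'X_[m]) = (a *: 'X_[m])%:P * 'X^w.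
  rewrite (mpolyE p) rmorph_sum coef_sum rmorph_sum /= rmorph_sum mulr_suml.
  apply: eq_bigr => m _; have [w ew] := H m p@_m.
  rewrite ew coefMXn; case: ltnP => wi; first by rewrite rmorph0 mul0r.
  rewrite coefC; case: eqP => [/eqP|_]; last by rewrite rmorph0 mul0r.
  by rewrite subn_eq0 ew => iw; rewrite (@anti_leq i w) // iw.
pose Q (p : {mpoly K[n * d]}) := exists w, wt_mor p = p%:P * 'X^w.
have QM q r : Q q -> Q r -> Q (q * r).
  case=> w eq [v er]; exists (w + v)%N; rewrite rmorphM polyCM exprD /=.
  by rewrite eq er mulrACA.
have Q1 : Q 1 by exists 0%N; rewrite rmorph1 mulr1.
rewrite -mul_mpolyC; apply: (QM); first by exists 0%N; rewrite substC mulr1.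
rewrite mpolyXE_id; apply: (big_ind Q); [exact: Q1 | exact: QM | move=> k _].
elim: (m k) => [|l IHl]; first by rewrite expr0; apply: (Q1).
rewrite exprS; apply: (QM) IHl.
case/mxvec_indexP: k => u v; exists (wt u v); exact: subst_var.
Qed.

Definition wt_grading := Grading wt_horner1 wt_coef.

Lemma hom_var i j : ishom wt_grading (wt i j) (lss_var K i j).
Proof. exact: subst_var. Qed.

Lemma hom_monomial (e : {set 'I_n}) j :
  ishom wt_grading (\sum_(i in e) wt i j) (\prod_(i in e) lss_var K i j).
Proof. by apply: hom_prod => i _; apply: hom_var. Qed.

End Weights.

Section LastColumn.

Variables (K : fieldType) (n c : nat).

Local Notation A := {mpoly K[n * c]}.
Local Notation P := {mpoly K[n * c.+1]}.

Definition inc_col : {rmorphism A -> P} :=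
  subst (mpolyC (n * c.+1) (R:=K)) (fun i j => lss_var K i (lift ord_max j)).

Let split_col : {rmorphism P -> {mpoly A[n]}} :=
  subst (mpolyC n (R:=A) \o mpolyC (n * c) (R:=K))
    (fun i j => if unlift ord_max j is Some j' then (lss_var K i j')%:MP else 'X_i).

Let join_col : {rmorphism {mpoly A[n]} -> P} :=
  mmap inc_col (fun i => lss_var K i ord_max).

Let split_colK : cancel split_col join_col.
Proof.
move=> p; apply: (@lss_rmorph_eq _ _ _ _ (join_col \o split_col) idfun) => [a|i j] /=.
  rewrite [split_col _]substC /= [join_col _]mmapC; exact: substC.
rewrite [split_col _]subst_var; case: unliftP => [j'|] ->.
  by rewrite [join_col _]mmapC; apply: subst_var.
by rewrite [join_col _]mmapX mmap1U.
Qed.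

Let split_inc a : split_col (inc_col a) = a%:MP.
Proof.
apply: (@lss_rmorph_eq _ _ _ _ (split_col \o inc_col) (mpolyC n (R:=A))) => [b|i j] /=.
  by rewrite [inc_col _]substC; apply: substC.
by rewrite [inc_col _]subst_var [split_col _]subst_var liftK.
Qed.

Let idl_split s p :
  idl (map inc_col s) p <-> forall m, idl s (split_col p)@_m.
Proof.
split=> [|Ip].
  elim: s p => [|u s IHs] p /=; first by move=> -> m; rewrite rmorph0 mcoeff0.
  case=> q /IHs Iq m; exists (split_col q)@_m.
  have := Iq m; rewrite rmorphB rmorphM /= split_inc mcoeffB.
  by rewrite mulrC mcoeffCM mulrC.
rewrite -[p]split_colK /join_col /= /mmap.
apply: ideal_sum => [|m _]; first exact: idl_ideal.
apply: ideal_mulr; first exact: idl_ideal.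
have inc_idl a : idl s a -> idl (map inc_col s) (inc_col a).
  elim: s {Ip} a => [a -> | u s IHs a [b /IHs Ib]]; first exact: rmorph0.
  by exists (inc_col b); rewrite -rmorphM -rmorphB.
exact: inc_idl.
Qed.

(** The ring with the last column is a polynomial ring over the one without it, so membership and
    multiplication by [inc_col u] are read on coefficients. *)
Lemma nzd_inc_col s u : nzd (idl s) u -> nzd (idl (map inc_col s)) (inc_col u).
Proof.
move=> zu g /idl_split Iug; apply/idl_split => m; apply: zu.
by have := Iug m; rewrite rmorphM /= split_inc mcoeffCM.
Qed.

Lemma nzd_last_col s i : nzd (idl (map inc_col s)) (lss_var K i ord_max).
Proof.
move=> g /idl_split Iug; apply/idl_split => m.
have := Iug (U_(i) + m)%MM.
rewrite rmorphM [split_col (lss_var _ _ _)]subst_var unlift_none /=.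
by rewrite mulrC mcoeffMX.
Qed.

Lemma inc_col_form e :
  inc_col (lss_form K c e) = \sum_(j < c) \prod_(i in e) lss_var K i (lift ord_max j).
Proof.
rewrite rmorph_sum; apply: eq_bigr => j _; rewrite rmorph_prod.
by apply: eq_bigr => i _; apply: subst_var.
Qed.

Lemma lss_formS e :
  lss_form K c.+1 e = inc_col (lss_form K c e) + \prod_(i in e) lss_var K i ord_max.
Proof.
rewrite inc_col_form /lss_form big_ord_recr /=; congr (_ + _).
apply: eq_bigr => j _; apply: eq_bigr => i _; congr lss_var; apply: val_inj.
by apply: esym; apply: lift_max.
Qed.

End LastColumn.

(** * Regularity of the forms in any order *)

Section StrongRegularity.

Variables (K : fieldType) (n k c : nat) (E : {set {set 'I_n}}).
Hypotheses (k_gt0 : (0 < k)%N) (c_gt0 : (0 < c)%N) (E_uniform : uniform k E).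

Local Notation A := {mpoly K[n * c]}.
Local Notation form := (lss_form K c).

Let deg := wt_grading K (fun (_ : 'I_n) (_ : 'I_c) => 1%N).

Let hom_form e : e \in E -> ishom deg k (form e).
Proof.
move=> eE; apply: hom_sum => j _.
by have := hom_monomial K (fun _ _ => 1%N) e j; rewrite sum1_card E_uniform.
Qed.

Let hom0_const a : ishom deg 0 a -> exists b, a = b%:MP.
Proof.
move=> ha; exists a.@[fun=> 0].
(* All variables have weight 1, so setting the grading variable to 0 sets them to 0; in weight 0
   this changes nothing. *)
transitivity (deg a).[0]; first by rewrite ha mulr1 hornerC.
apply: (@lss_rmorph_eq _ _ _ _ (horner_eval 0 \o deg)
  (mpolyC (n * c) (R:=K) \o meval (fun=> 0))) => [b|i j] /=.
  by rewrite substC /horner_eval hornerC mevalC.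
by rewrite subst_var /horner_eval hornerM hornerX mulr0 mevalXU mpolyC0.
Qed.

(* Evaluate at the indicator function of e in the first column: the forms of the
   other edges vanish there, since no edge contains another. *)
Let form_indep (l : seq {set 'I_n}) : uniq l -> {subset l <= E} ->
  forall a : 'cV_(size (map form l)), (forall i, ishom deg 0 (a i 0)) ->
  rowseq (map form l) *m a = 0 -> a = 0.
Proof.
move=> ul lE a ha e0; apply/colP => i; rewrite mxE.
have [b bE] := choice (fun i => hom0_const (ha i)).
have szl := size_map form l.
have ltl (j : 'I_(size (map form l))) : (j < size l)%N by rewrite -szl.
pose e j := nth set0 l j.
have eE (j : 'I_(size (map form l))) : e j \in E by apply/lE/mem_nth.
pose v (x : 'I_(n * c)) : K :=
  ((pair_of_index x).1 \in e i)%:R * (val (pair_of_index x).2 == 0%N)%:R.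
have ev (j : 'I_(size (map form l))) : (form (e j)).@[v] = (i == j)%:R.
  rewrite /lss_form rmorph_sum /= (bigD1 (Ordinal c_gt0)) //= [X in _ + X]big1 ?addr0.
    rewrite rmorph_prod; under eq_bigr => x _.
      rewrite /= /lss_var mevalXU /v pair_of_indexK /= mulr1; over.
    have [<-|ne] := eqVneq i j; first by rewrite big1 // => x ->.
    have [x xj xi] : exists2 x, x \in e j & x \notin e i.
      apply/subsetPn; apply: contra ne => sub.
      have /eqP eij : e j == e i by rewrite eqEcard sub !(E_uniform (eE _)) leqnn.
      by apply/eqP/val_inj/eqP; rewrite -(nth_uniq set0 _ _ ul) ?ltl //; apply/eqP.
    by rewrite (bigD1 x) //= (negPf xi) mul0r.
  move=> j' nj'; rewrite rmorph_prod.
  have [x xj] : exists x, x \in e j.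
    by apply/set0Pn; rewrite -card_gt0 (E_uniform (eE j)).
  rewrite (bigD1 x) //= /lss_var mevalXU /v pair_of_indexK /=.
  have -> : (val j' == 0%N) = false.
    by apply: contra_neqF nj' => /eqP j0; apply: val_inj.
  by rewrite mulr0 mul0r.
have := congr1 (fun M : 'M_1 => (M 0 0).@[v]) e0.
rewrite /= !mxE rmorph_sum /= meval0 (bigD1 i) //= big1 => [|j nji].
  rewrite addr0 mxE (nth_map set0) ?ltl // mevalM ev eqxx mul1r bE mevalC => ->.
  by rewrite mpolyC0.
by rewrite mxE (nth_map set0) ?ltl // mevalM ev eq_sym (negPf nji) mul0r.
Qed.

(** List the forms of [E] with [e :: F] at the end. Koszul exactness passes from the regular
    sequence to this list, survives deleting the forms before [e] one at a time, and then gives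
    regularity of the head. *)
Lemma complete_intersection_nzd : complete_intersection (lss_ideal K c E) ->
  forall e F, uniq (e :: F) -> {subset e :: F <= E} ->
  nzd (idl (map form F)) (form e).
Proof.
case=> s /koszul_exact_regular Ks eqs e F uF FE.
pose rest := [seq x <- enum E | x \notin e :: F].
have memR : rest ++ e :: F =i E.
  move=> x; rewrite mem_cat mem_filter mem_enum.
  by have [/FE ->|] := boolP (x \in e :: F); rewrite ?orbT ?orbF.
have uR : uniq (rest ++ e :: F).
  rewrite cat_uniq filter_uniq ?enum_uniq // uF andbT andTb.
  by apply/hasPn => x xF; rewrite mem_filter xF.
have hR v l : {subset l <= E} -> v \in map form l -> ishom deg k v.
  by move=> lE /mapP[x /lE xE ->]; apply: hom_form.
have : koszul_exact (rowseq (map form (rest ++ e :: F))).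
  apply: (koszul_exact_generators (phi := deg) (k := k) Ks).
  - move=> p; have -> : idl (rev s) p <-> idl s p.
      by split; apply: idl_subset => x; rewrite mem_rev.
    have eqE : idl s p <-> idl (map form (enum E)) p.
      by rewrite -!idlP -/(lss_ideal K c E) (eqs p).
    rewrite eqE; split; apply: idl_subset => _ /mapP[x xl ->]; apply: map_f.
      by rewrite memR; move: xl; rewrite mem_enum.
    by rewrite mem_enum -memR.
  - by move=> v; apply: hR => x; rewrite memR.
  - by apply: form_indep => // x; rewrite memR.
have : {subset rest ++ e :: F <= E} by move=> x; rewrite memR.
elim: (rest) => [|x r IHr] rE; first exact: koszul_exact_nzd.
rewrite cat_cons map_cons => Kr; apply: IHr => [y yr|].
  by apply: rE; rewrite cat_cons inE yr orbT.
apply: (koszul_exact_behead (phi := deg) (k := k) k_gt0 _ _ Kr).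
  by apply/hom_form/rE; rewrite mem_head.
by move=> v; apply: hR => y yr; apply: rE; rewrite cat_cons inE yr orbT.
Qed.

End StrongRegularity.

(** * Adding the edges through a vertex *)

Section PolynomialIdeal.

Variables (R : comNzRingType) (I : R -> Prop).
Hypothesis iI : ideal I.

Definition poly_ideal (p : {poly R}) := forall i, I p`_i.

Lemma poly_ideal_ideal : ideal poly_ideal.
Proof.
split=> [i|p q Ip Iq i|a p Ip i]; first by rewrite coef0; apply: ideal0.
  by rewrite coefD; apply: idealD.
by rewrite coefM; apply: ideal_sum => // j _; apply: ideal_mull.
Qed.

Lemma poly_idealC a : I a -> poly_ideal a%:P.
Proof. by move=> Ia i; rewrite coefC; case: eqP => // _; apply: ideal0. Qed.

(** Take the least [i] for which the coefficient of [p] is outside [I], and induct on [j]: in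
    coefficient [i + j] of [p * q], every term except coefficient [i] of [p] times coefficient [j]
    of [q] lies in [I]. *)
Lemma poly_ideal_prime : (forall a b, I (a * b) -> I a \/ I b) ->
  forall p q, poly_ideal (p * q) -> poly_ideal p \/ poly_ideal q.
Proof.
move=> prI p q Ipq.
have [Ip|/existsNP[i0 i0p]] := pselect (poly_ideal p); first by left.
right; pose badp i := ~~ `[< I p`_i >].
have [|i /asboolPn ip mini] := @ex_minnP badp; first by exists i0; apply/asboolPn.
elim/ltn_ind => j IHj.
have Ipi a : (a < i)%N -> I p`_a.
  by move=> ai; apply/asboolP; apply: contraLR ai => /mini; rewrite -leqNgt.
have := Ipq (i + j)%N; rewrite coefM.
have lt_i : (i < (i + j).+1)%N by rewrite ltnS leq_addr.
rewrite (bigD1 (Ordinal lt_i)) //= addKn => Is.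
case: (prI p`_i q`_j) => //.
move: Is; set s := \sum_(_ | _) _ => Is; rewrite -(addrK s (p`_i * q`_j)).
apply: idealB => //; apply: ideal_sum => // a nai.
have [lt|ge] := ltnP a i; first by apply: ideal_mulr => //; apply: Ipi.
apply: ideal_mull => //; apply: IHj.
have lt : (i < a)%N.
  by rewrite ltn_neqAle ge andbT; apply: contra nai => /eqP ia; apply/eqP/val_inj.
by rewrite ltn_subLR ?ltn_add2r // -ltnS.
Qed.

End PolynomialIdeal.

Section Vertex.

Variables (K : fieldType) (n k c : nat) (v : 'I_n) (E : {set {set 'I_n}}).
Hypotheses (k_gt0 : (0 < k)%N) (E_uniform : uniform k E).

Local Notation P := {mpoly K[n * c.+1]}.
Local Notation y := (lss_var K).
Local Notation form := (@lss_form K n c.+1).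

Definition old_form (e : {set 'I_n}) : P := inc_col K n c (lss_form K c e).

Hypothesis old_nzd : forall e F, uniq (e :: F) -> {subset e :: F <= E} ->
  nzd (idl (map old_form F)) (old_form e).

Let Ev := [seq e : {set 'I_n} <- enum E | v \in e].
Let E0 := [seq e : {set 'I_n} <- enum E | v \notin e].
Let t := size Ev.
Let ed (i : 'I_t) : {set 'I_n} := nth set0 Ev i.

Let edE i : ed i \in E.
Proof.
by have : ed i \in Ev by [apply: mem_nth]; rewrite mem_filter mem_enum => /andP[].
Qed.

Let v_ed i : v \in ed i.
Proof.
by have : ed i \in Ev by [apply: mem_nth]; rewrite mem_filter mem_enum => /andP[].
Qed.

Let ed_inj : injective ed.
Proof.
have uEv : uniq Ev by rewrite filter_uniq ?enum_uniq.
move=> i j /eqP; rewrite (nth_uniq set0 (ltn_ord i) (ltn_ord j) uEv).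
by move=> /eqP/val_inj.
Qed.

Let map_ed : map ed (enum 'I_t) = Ev.
Proof.
rewrite /ed -[in RHS](mkseq_nth set0 Ev) /mkseq -val_enum_ord -map_comp.
exact: eq_map.
Qed.

Let card_ed i : #|ed i :\ v| = k.-1.
Proof. by rewrite -(E_uniform (edE i)) (cardsD1 v (ed i)) v_ed. Qed.

Let E0E e : e \in E0 -> (e \in E) /\ (v \notin e).
Proof. by rewrite mem_filter mem_enum andbC => /andP. Qed.

Definition cofactor_monomial (i : 'I_t) (j : 'I_c.+1) : P := \prod_(a in ed i :\ v) y a j.

Local Notation g := cofactor_monomial.

Let prod_ed i j : \prod_(a in ed i) y a j = g i j * y v j.
Proof. by rewrite (big_setD1 v) //= mulrC. Qed.

(** The forms of the edges through [v] are linear in the variables of [v]: [l] collects them without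
    the last column and [x] in full ([lE], [xE]). *)
Let G : 'M[P]_(t, c) := \matrix_(i, j) g i (lift ord_max j).
Let yv : 'cV[P]_c := \col_j y v (lift ord_max j).
Let Z : 'cV[P]_t := \col_i g i ord_max.
Let w : P := y v ord_max.
Let l : 'cV[P]_t := G *m yv.
Let x : 'cV[P]_t := l + w *: Z.

Let lE i : l i 0 = old_form (ed i).
Proof.
rewrite mxE /old_form inc_col_form; apply: eq_bigr => j _.
by rewrite !mxE prod_ed.
Qed.

Let xE i : x i 0 = form (ed i).
Proof. by rewrite lss_formS -/(old_form _) -lE 3!mxE prod_ed mulrC [Z i 0]mxE. Qed.

Let gens_l F : gens l F = map old_form (map ed F).
Proof. by rewrite -map_comp; apply: eq_map => i; apply: lE. Qed.

Let gens_x F : gens x F = map form (map ed F).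
Proof. by rewrite -map_comp; apply: eq_map => i; apply: xE. Qed.

Let s0 := map old_form E0.

Let l_nzd e F : uniq (e :: F) -> nzd (idl (gens l F ++ s0)) (l e 0).
Proof.
move=> uF; rewrite lE gens_l -map_cat; apply: old_nzd; last first.
  by move=> a; rewrite -cat_cons -map_cons mem_cat => /orP[/mapP[i _ ->]|/E0E[]].
rewrite -cat_cons -map_cons cat_uniq map_inj_uniq // uF filter_uniq ?enum_uniq //.
rewrite andbT andTb; apply/hasPn => a /E0E[_ va]; apply: contra va.
by case/mapP => i _ ->.
Qed.

Let s0_reg : regseq 1 s0.
Proof.
have : uniq E0 by rewrite filter_uniq ?enum_uniq.
have : {subset E0 <= E} by move=> e /E0E[].
rewrite /s0; elim: E0 => [|e F IHF] // FE uF; split.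
  by apply: nzd_sgen; apply: old_nzd.
apply: IHF => [a aF|]; first by apply: FE; rewrite inE aF orbT.
by case/andP: uF.
Qed.

Let gens_s0 F : gens l F ++ s0 = map (inc_col K n c) (map (lss_form K c) (map ed F ++ E0)).
Proof. by rewrite gens_l -map_cat -map_comp. Qed.

Let Z_nzd e : nzd (idl (gens l (enum 'I_t) ++ s0)) (Z e 0).
Proof.
rewrite mxE gens_s0; apply: nzd_prod => a _; exact: nzd_last_col.
Qed.

(** Weight [k] on the variables of [v] outside the last column makes [l] dominate. The weight of
    [Z i 0] counts the vertices of the edge, other than [v], that lie in [S], so it is at most
    [k.-1]. *)
Let wt (S : {set 'I_n}) (i : 'I_n) (j : 'I_c.+1) : nat :=
  if i == v then (if j == ord_max then 0 else k)
  else (if j == ord_max then (i \in S : nat) else 0).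

Let lift_neq j : (lift ord_max j == ord_max :> 'I_c.+1) = false.
Proof. by rewrite eq_sym (negPf (neq_lift _ _)). Qed.

Let hom_g S i j :
  ishom (wt_grading K (wt S)) (\sum_(a in ed i :\ v) wt S a j) (g i j).
Proof. exact: hom_monomial. Qed.

Let wt_last S i : (\sum_(a in ed i :\ v) wt S a ord_max = #|(ed i :\ v) :&: S|)%N.
Proof.
rewrite -sum1_card (big_setID S) /= [X in (_ + X)%N]big1 ?addn0.
  apply: eq_bigr => a; rewrite !inE /wt eqxx => /andP[/andP[/negPf -> _] ->] //.
by move=> a; rewrite !inE /wt eqxx => /and3P[/negPf -> /negPf -> _].
Qed.

Let wt_compatible S : compatible G yv Z w s0 k (wt_grading K (wt S)).
Proof.
split.
- move=> u /mapP[e /E0E[_ ve] ->]; rewrite /old_form inc_col_form.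
  apply: hom_sum => j _; have := hom_monomial K (wt S) e (lift ord_max j).
  rewrite big1 // => a ae; rewrite /wt lift_neq; case: eqP => // av.
  by rewrite -av ae in ve.
- move=> i j; rewrite mxE; have := hom_g S i (lift ord_max j).
  by rewrite big1 // => a; rewrite !inE /wt lift_neq => /andP[/negPf ->].
- by move=> j; rewrite mxE; have := hom_var K (wt S) v (lift ord_max j);
    rewrite /wt eqxx lift_neq.
- by have := hom_var K (wt S) v ord_max; rewrite /wt !eqxx.
- move=> i; rewrite mxE; apply: size_hom_leq (hom_g S i ord_max) _.
  rewrite wt_last -[X in (_ < X)%N](prednK k_gt0) ltnS -(card_ed i).
  by apply/subset_leq_card/subsetIl.
Qed.

(** With [S] the edge [ed e0], weight [k.-1] is reached only by an edge contained in [ed e0], hence,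
    by uniformity, equal to it. *)
Let separating e0 : exists (phi : grading P) k0,
  [/\ compatible G yv Z w s0 k phi, ishom phi k0 (Z e0 0) &
      forall e, e != e0 -> (size (phi (Z e 0)%R) <= k0)%N].
Proof.
exists (wt_grading K (wt (ed e0))), k.-1; split; first exact: wt_compatible.
  rewrite mxE; have := hom_g (ed e0) e0 ord_max.
  by rewrite wt_last (setIidPl (subsetDl _ _)) card_ed.
move=> e ne; rewrite mxE; apply: size_hom_leq (hom_g _ e ord_max) _.
rewrite wt_last -(card_ed e); apply: proper_card; rewrite properE subsetIl /=.
apply: contra ne => sub; have : ed e \subset ed e0.
  apply/subsetP => a ae; have [->|nav] := eqVneq a v; first exact: v_ed.
  by have /(subsetP sub) : a \in ed e :\ v; rewrite !inE ?nav // => /andP[].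
move=> sub'; apply/eqP/ed_inj/eqP.
by rewrite eqEcard sub' !(E_uniform (edE _)) leqnn.
Qed.

(** [w] is a variable of the last column, so it is regular modulo the forms in the first columns;
    having weight 0, it stays so when [l] is perturbed to [x]. *)
Let w_nzd : nzd (idl (gens x (enum 'I_t) ++ s0)) w.
Proof.
have cp := wt_compatible set0; have [_ _ _ hw _] := cp.
apply: (perturbation_nzd l_nzd s0_reg cp (enum_uniq _) hw).
by rewrite gens_s0; apply: nzd_last_col.
Qed.

Let wt1 (i : 'I_n) (j : 'I_c.+1) : nat :=
  if i == v then (if j == ord_max then k.-1 else 0)
  else (if j == ord_max then 0 else 1).

Let L := idl (gens x (enum 'I_t) ++ map form E0).

(* The weights wt1 make the forms of the edges at v homogeneous, and degenerate the
   form of any other edge to its part without the last column. *)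
Let minors_annihilator_form h :
  (forall (r : {ffun 'I_t -> 'I_t}) q, L (minor G r q * h)) -> L h.
Proof.
pose phi := wt_grading K wt1.
pose ps := [seq (x i 0, x i 0) | i <- enum 'I_t] ++ [seq (form e, old_form e) | e <- E0].
have fstE : map fst ps = gens x (enum 'I_t) ++ map form E0.
  by rewrite /ps map_cat; congr (_ ++ _); rewrite -map_comp; apply: eq_map.
have sndE : map snd ps = gens x (enum 'I_t) ++ s0.
  by rewrite /ps map_cat; congr (_ ++ _); rewrite -map_comp; apply: eq_map.
have hg i j : ishom phi (if j == ord_max then 0 else k.-1)%N (g i j).
  have := hom_monomial K wt1 (ed i :\ v) j.
  suff -> : (\sum_(a in ed i :\ v) wt1 a j = if j == ord_max then 0 else k.-1)%N by [].
  rewrite -(card_ed i) -sum1_card; case: (boolP (j == _)) => jm.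
    by rewrite big1 // => a; rewrite !inE /wt1 jm => /andP[/negPf ->].
  by apply: eq_bigr => a; rewrite !inE /wt1 (negPf jm) => /andP[/negPf ->].
have hx i : ishom phi k.-1 (x i 0).
  rewrite xE; apply: hom_sum => j _; rewrite prod_ed.
  have := homM (hg i j) (hom_var K wt1 v j); rewrite /wt1 eqxx.
  by case: (j == _); rewrite ?addn0.
have hold e : e \in E0 -> lead_form phi k (old_form e) (form e).
  case/E0E=> eE ve; have vn a : a \in e -> (a == v) = false.
    by apply: contraTF => /eqP ->.
  split.
    rewrite /old_form inc_col_form; apply: hom_sum => j _.
    have := hom_monomial K wt1 e (lift ord_max j).
    rewrite -(E_uniform eE) -sum1_card; congr (ishom _ _ _).
    by apply: eq_bigr => a /vn; rewrite /wt1 lift_neq => ->.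
  rewrite lss_formS addrAC subrr add0r; apply: size_hom_leq (hom_monomial _ _ _ _) _.
  by rewrite big1 // => a /vn; rewrite /wt1 eqxx => ->.
have ini : initial phi 1 ps.
  apply: initial_regseq; [exact: hom1 | exact: oner_neq0 | |].
    move=> p; rewrite mem_cat => /orP[/mapP[i _ ->]|/mapP[e eE ->]].
      by exists k.-1; apply: hom_lead (hx i).
    by exists k; apply: hold.
  rewrite sndE.
  exact: (perturbation_reg l_nzd s0_reg (wt_compatible set0) (enum_uniq _)).
move=> Lh; apply/sgen1; rewrite -fstE.
apply: (annihilator_initial
  (D := fun p : {ffun 'I_t -> 'I_t} * {ffun 'I_t -> 'I_c} => minor G p.1 p.2) ini).
- move=> [r q]; exists (t * k.-1)%N; apply: hom_det => i j.
  by rewrite !mxE; have := hg (r i) (lift ord_max (q j)); rewrite lift_neq.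
- rewrite sndE => h' Xh; apply/sgen1.
  apply: (minors_annihilator l_nzd s0_reg Z_nzd w_nzd separating (leqnn t)) => r q.
  by apply/sgen1; apply: (Xh (r, q)).
- by move=> [r q]; rewrite fstE; apply/sgen1; apply: Lh.
Qed.

Let L0 := idl (map form E0).

(** * Cramer's rule where a maximal minor is invertible *)

Section Cramer.

Variables (r : {ffun 'I_t -> 'I_t}) (q : {ffun 'I_t -> 'I_c}).
Let d := minor G r q.
Hypothesis d_neq0 : d != 0.

Let M := mxsub r q G.
Let q' j : 'I_c.+1 := lift ord_max (q j).

Let q'_inj : injective q'.
Proof.
move=> i j /lift_inj eqq; apply: contraNeq d_neq0 => neq_ij; apply/eqP.
rewrite /d /minor -det_tr; apply: (determinant_alternate neq_ij) => a.
by rewrite !mxE eqq.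
Qed.

Let free l' := l' \notin codom q'.
Let yq : 'cV[P]_t := \col_j y v (q' j).
Let rest : 'cV[P]_t := \col_i \sum_(l' | free l') g (r i) l' * y v l'.
Let N : 'cV[P]_t := - (\adj M *m rest).

Let sum_split (F : 'I_c.+1 -> P) :
  \sum_l' F l' = \sum_j F (q' j) + \sum_(l' | free l') F l'.
Proof.
rewrite (bigID free) /= addrC; congr (_ + _).
have uq : uniq (codom q') by rewrite map_inj_uniq ?enum_uniq.
transitivity (\sum_(a <- codom q') F a).
  by rewrite big_uniq //; apply: eq_bigl => a; rewrite /free negbK.
by rewrite big_map big_enum.
Qed.

Let xrE i : x (r i) 0 = (M *m yq + rest) i 0.
Proof.
rewrite xE /lss_form; under eq_bigr do rewrite prod_ed.
by rewrite sum_split !mxE; congr (_ + _); apply: eq_bigr => j _; rewrite !mxE.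
Qed.

(** Cramer's rule solves [x = 0] for the variables of [v] in the columns [q']: [d] times them is
    [N]. To avoid fractions, the free variables of [v] are multiplied by [d]; the power of ['X]
    records the degree in the variables of [v]. *)
Definition cramer_fun i l' : {poly P} :=
  if i == v then (if [pick j | q' j == l'] is Some j then N j 0 else d * y v l')%:P * 'X
  else (y i l')%:P.

(** The same scaling without solving for anything; by [psi_phi] it agrees with the Cramer
    substitution modulo [L]. *)
Definition scale_fun i l' : {poly P} :=
  if i == v then (d * y v l')%:P * 'X else (y i l')%:P.

Variables psi phi : {rmorphism P -> {poly P}}.
Hypotheses (psiC : forall a, psi a%:MP = a%:MP%:P)
  (psiE : forall i l', psi (y i l') = cramer_fun i l')
  (phiC : forall a, phi a%:MP = a%:MP%:P)
  (phiE : forall i l', phi (y i l') = scale_fun i l').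

Let psi_free (S : {set 'I_n}) j : v \notin S ->
  psi (\prod_(a in S) y a j) = (\prod_(a in S) y a j)%:P.
Proof.
move=> vS; rewrite !rmorph_prod; apply: eq_bigr => a aS.
rewrite psiE /cramer_fun; case: eqP => // av.
by rewrite av (negPf vS) in aS.
Qed.

Let psi_g i j : psi (g i j) = (g i j)%:P.
Proof. by apply: psi_free; rewrite !inE eqxx. Qed.

Let psi_minor (r' : {ffun 'I_t -> 'I_t}) (q'' : {ffun 'I_t -> 'I_c}) :
  psi (minor G r' q'') = (minor G r' q'')%:P.
Proof.
rewrite /minor -!det_map_mx; congr (\det _); apply/matrixP => i j.
by rewrite !mxE; apply: psi_g.
Qed.

Let psi_form e : e \in E0 -> psi (form e) = (form e)%:P.
Proof.
case/E0E=> _ ve; rewrite !rmorph_sum; apply: eq_bigr => j _.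
exact: psi_free.
Qed.

Let psi_q j : psi (y v (q' j)) = (N j 0)%:P * 'X.
Proof.
rewrite psiE /cramer_fun eqxx; case: pickP => [i /eqP/q'_inj -> //|no].
by exfalso; move: (no j); rewrite eqxx.
Qed.

Let psi_y l' : free l' -> psi (y v l') = (d * y v l')%:P * 'X.
Proof.
move=> fl; rewrite psiE /cramer_fun eqxx; case: pickP => [j /eqP ql|_]; last exact: erefl.
by exfalso; case/negP: fl; rewrite -ql codom_f.
Qed.

Let r_onto i : exists j, r j = i.
Proof.
have r_inj : injective r := minor_inj d_neq0.
by exists (invF r_inj i); rewrite f_invF.
Qed.

Let psi_x i : psi (x i 0) = 0.
Proof.
have [j <-] := r_onto i; rewrite xrE !mxE rmorphD !rmorph_sum /=.
have -> : \sum_(a < t) psi (M j a * yq a 0) = ((M *m N) j 0)%:P * 'X.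
  rewrite mxE rmorph_sum /= mulr_suml; apply: eq_bigr => a _.
  rewrite [yq a 0]mxE rmorphM psi_q !mxE mulrA; congr (_ * _).
  by rewrite psi_g polyCM.
have -> : \sum_(a | free a) psi (g (r j) a * y v a) = (d * rest j 0)%:P * 'X.
  rewrite mxE mulr_sumr rmorph_sum /= mulr_suml; apply: eq_bigr => a fa.
  rewrite rmorphM psi_g psi_y // mulrA; congr (_ * _).
  by rewrite -polyCM mulrCA.
rewrite -mulrDl -polyCD mulmxN mulmxA mul_mx_adj mul_scalar_mx.
by rewrite ![in X in X%:P]mxE addNr polyC0 mul0r.
Qed.

Let iL : ideal L. Proof. exact: idl_ideal. Qed.
Let iL0 : ideal L0. Proof. exact: idl_ideal. Qed.

Let L0L p : L0 p -> L p.
Proof. by apply: idl_subset => a; rewrite mem_cat => ->; rewrite orbT. Qed.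

Let Lx i : L (x i 0).
Proof. by apply: idl_mem; rewrite mem_cat (map_f (fun i => x i 0)) ?mem_enum. Qed.

Let psi_phi p : poly_ideal L (psi p - phi p).
Proof.
have iX := poly_ideal_ideal iL.
apply: (lss_rmorph_mod (f := psi) (g := phi) iX _ _ p) => [a|i l'].
  by rewrite psiC phiC subrr; exact: (ideal0 iX).
rewrite psiE phiE /cramer_fun /scale_fun.
case: eqP => [_|_]; last by rewrite subrr; exact: (ideal0 iX).
case: pickP => [j /eqP <-|_]; last by rewrite subrr; exact: (ideal0 iX).
rewrite -mulrBl -polyCB; apply: (ideal_mulr iX); apply: (poly_idealC iL).
have -> : N j 0 - d * y v (q' j) = - (\adj M *m rowsub r x) j 0.
  have -> : rowsub r x = M *m yq + rest by apply/colP => a; rewrite mxE xrE.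
  rewrite mulmxDr mulmxA mul_adj_mx mul_scalar_mx -[\det M]/d.
  rewrite -[\adj M *m rest]opprK -/N.
  have -> : (d *: yq - N) j 0 = d * yq j 0 - N j 0.
    by rewrite mxE [(d *: yq) j 0]mxE [(- N) j 0]mxE.
  by rewrite [yq j 0]mxE opprB.
apply: (idealN iL); rewrite mxE; apply: (ideal_sum _ iL) => a _.
by apply: (ideal_mull iL); rewrite mxE; apply: Lx.
Qed.

(** [J] is the preimage under [psi] of the extension of [L0]: prime as [L0] is, and containing [L]
    since [psi] kills [x] and fixes the other forms. Conversely, for [p] in [J] the coefficients of
    [phi p] lie in [L], which puts a power of [d] times [p] in [L]. *)
Lemma cramer_prime : (forall a b, L0 (a * b) -> L0 a \/ L0 b) ->
  exists J : P -> Prop,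
  [/\ ideal J, forall a b, J (a * b) -> J a \/ J b, forall p, L p -> J p,
      (J 1 -> L0 1) /\
        forall (r' : {ffun 'I_t -> 'I_t}) (q'' : {ffun 'I_t -> 'I_c}),
          J (minor G r' q'') -> L0 (minor G r' q'') &
      forall p, J p -> exists D, L (d ^+ D * p)].
Proof.
move=> prL0; have iX := poly_ideal_ideal iL0.
exists (fun p => poly_ideal L0 (psi p)).
have constP a : poly_ideal L0 a%:P -> L0 a by move=> /(_ 0%N); rewrite coefC eqxx.
have iJ : ideal (fun p => poly_ideal L0 (psi p)).
  split=> [|a b Ja Jb|a b Jb].
  - by rewrite rmorph0; exact: (ideal0 iX).
  - by rewrite rmorphD; exact: (idealD iX).
  - by rewrite rmorphM; exact: (ideal_mull iX).
split; first exact: iJ.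
- by move=> a b; rewrite rmorphM; apply: (poly_ideal_prime iL0 prL0).
- move=> p; apply: (idl_sub iJ) => u; rewrite mem_cat => /orP[/mapP[i _ ->]|].
    by rewrite psi_x; exact: (ideal0 iX).
  case/mapP => e eE ->; rewrite psi_form //; apply: (poly_idealC iL0).
  exact/idl_mem/map_f.
- split; first by rewrite rmorph1 -polyC1 => /constP.
  by move=> r' q''; rewrite psi_minor => /constP.
move=> p Jp; pose wtv (i : 'I_n) (j : 'I_c.+1) : nat := (i == v).
pose gr := wt_grading K wtv.
(* [phi] multiplies the component of degree [i] in the variables of [v] by [d ^+ i]. *)
have phip : phi p = \sum_(i < size (gr p)) ((gr p)`_i * d ^+ i)%:P * 'X^i.
  transitivity (gr p \Po (d%:P * 'X)).
    apply: (@lss_rmorph_eq _ _ _ _ phi (comp_poly (d%:P * 'X) \o gr)) => [a|i j] /=.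
      by rewrite phiC [gr _]substC comp_polyC.
    rewrite phiE [gr _]subst_var /scale_fun /wtv comp_polyM comp_polyC.
    case: eqP => [->|_]; last by rewrite expr0 -[1]polyC1 comp_polyC mulr1.
    by rewrite expr1 comp_polyX polyCM mulrCA mulrA.
  rewrite comp_polyE; apply: eq_bigr => i _.
  by rewrite exprMn -polyC_exp scalerAl scale_polyC.
have Lphi : poly_ideal L (phi p).
  rewrite -(subKr (psi p) (phi p)).
  have Lpsi : poly_ideal L (psi p) by move=> i; apply/L0L/Jp.
  exact: (idealB (poly_ideal_ideal iL) Lpsi (psi_phi p)).
exists (size (gr p)); rewrite -[X in L (_ * X)](gr_horner1 gr) horner_coef mulr_sumr.
apply: (ideal_sum _ iL) => i _; rewrite expr1n mulr1.
have -> : d ^+ size (gr p) * (gr p)`_i = (gr p)`_i * d ^+ i * d ^+ (size (gr p) - i).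
  by rewrite -mulrA -exprD subnKC ?(ltnW (ltn_ord i)) // mulrC.
apply: (ideal_mulr iL).
have := Lphi i; rewrite phip coef_sum (bigD1 i) //= big1 => [|j nji].
  by rewrite addr0 coefMXn ltnn subnn coefC eqxx.
rewrite coefCM coefXn eq_sym; case: eqP => [/val_inj ji|]; last by rewrite mulr0.
by rewrite ji eqxx in nji.
Qed.

End Cramer.

Let LE p : L p <-> idl (map form (enum E)) p.
Proof.
rewrite /L gens_x map_ed -map_cat.
by split; apply: idl_subset => _ /mapP[e eE ->]; apply: map_f; move: eE;
  rewrite mem_cat !mem_filter -andb_orl orbN.
Qed.

Lemma vertex_prime :
    (forall a b, idl (map form [seq e : {set 'I_n} <- enum E | v \notin e]) (a * b) ->
       idl (map form [seq e : {set 'I_n} <- enum E | v \notin e]) a \/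
       idl (map form [seq e : {set 'I_n} <- enum E | v \notin e]) b) ->
    ~ idl (map form (enum E)) 1 ->
  forall a b, idl (map form (enum E)) (a * b) ->
    idl (map form (enum E)) a \/ idl (map form (enum E)) b.
Proof.
rewrite -/E0 -/L0 => prL0 /LE nL1; have iL : ideal L := idl_ideal _.
have L0L p : L0 p -> L p.
  by apply: idl_subset => a; rewrite mem_cat => ->; rewrite orbT.
have nz (r : {ffun 'I_t -> 'I_t}) (q : {ffun 'I_t -> 'I_c}) :
    ~ L0 (minor G r q) -> minor G r q != 0.
  by move=> nL; apply: contra_notN nL => /eqP ->; apply: ideal0 (idl_ideal _).
(* If all maximal minors were in [L0], they would kill 1 modulo [L], and [L] would be the whole
   ring. *)
have [r [q nL0]] : exists (r : {ffun 'I_t -> 'I_t}) (q : {ffun 'I_t -> 'I_c}),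
    ~ L0 (minor G r q).
  apply: contrapT => H; apply: nL1; apply: minors_annihilator_form => r q.
  rewrite mulr1; apply: L0L; apply: contrapT => nL0.
  by apply: H; exists r, q.
have cramer (r' : {ffun 'I_t -> 'I_t}) (q' : {ffun 'I_t -> 'I_c}) (nL : ~ L0 (minor G r' q')) :
    exists J : P -> Prop,
    [/\ ideal J, forall a b, J (a * b) -> J a \/ J b, forall p, L p -> J p,
        (J 1 -> L0 1) /\
          forall (r'' : {ffun 'I_t -> 'I_t}) (q'' : {ffun 'I_t -> 'I_c}),
            J (minor G r'' q'') -> L0 (minor G r'' q'') &
        forall p, J p -> exists D, L (minor G r' q' ^+ D * p)].
  have [psi psiC psiE] := substitution_exists (S := {poly P}) (polyC \o mpolyC _ (R:=K)) (cramer_fun r' q').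
  have [phi phiC phiE] := substitution_exists (S := {poly P}) (polyC \o mpolyC _ (R:=K)) (scale_fun r' q').
  exact: (cramer_prime (nz _ _ nL) psiC psiE phiC phiE prL0).
have [J [iJ prJ LJ _ JL]] := cramer _ _ nL0.
suff JL' p : J p -> L p.
  by move=> a b /LE/LJ/prJ[] /JL'/LE; [left | right].
move=> Jp; apply: (annihilator_power
  (D := fun p : {ffun 'I_t -> 'I_t} * {ffun 'I_t -> 'I_c} => minor G p.1 p.2) iL).
  by move=> h Xh; apply: minors_annihilator_form => r' q'; apply: (Xh (r', q')).
move=> [r' q'] /=; have [L0d|nL0'] := pselect (L0 (minor G r' q')).
  by exists 1%N; rewrite expr1; apply: ideal_mulr => //; apply: L0L.
(* The prime [J'] of this second minor contains a power of the first minor times [p] but not the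
   first minor, hence [p]; so a power of the second minor kills [p]. *)
have [J' [iJ' prJ' LJ' [J'1 J'd] J'L]] := cramer _ _ nL0'.
have [D /LJ'] := JL p Jp; suff H : J' (minor G r q ^+ D * p) -> J' p by move/H/J'L.
elim: D => [|D IHD]; first by rewrite expr0 mul1r.
by rewrite exprS -mulrA => /prJ'[/J'd|/IHD].
Qed.

End Vertex.

(** * Induction on the number of edges *)

Section Main.

Variables (K : fieldType) (n k c : nat).
Hypothesis k_gt0 : (0 < k)%N.

(** All forms vanish at the origin, edges being nonempty. *)
Lemma form_proper (E : {set {set 'I_n}}) s : uniform k E ->
  {subset s <= E} -> ~ idl (map (lss_form K c.+1) s) 1.
Proof.
move=> Eu sE I1; have : (1 : {mpoly K[n * c.+1]}).@[fun=> 0] = 0.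
  apply: (idl_sub (I := fun p => p.@[fun=> 0] = 0)) I1.
    split=> [|p q p0 q0|a p p0]; first exact: meval0.
      by rewrite mevalD p0 q0 addr0.
    by rewrite mevalM p0 mulr0.
  move=> _ /mapP[e /sE eE ->]; rewrite rmorph_sum big1 // => j _.
  have [x xe] : exists x, x \in e by apply/set0Pn; rewrite -card_gt0 (Eu e eE).
  by rewrite rmorph_prod (bigD1 x) //= mevalXU mul0r.
by rewrite meval1 => /eqP; rewrite oner_eq0.
Qed.

(** Regularity is inherited by subsets of [E], so one can induct on a bound for the number of edges:
    deleting the edges through a vertex of some edge leaves fewer, and without edges the ideal is
    zero in a domain. *)
Lemma form_prime (E : {set {set 'I_n}}) : uniform k E ->
    (forall e F, uniq (e :: F) -> {subset e :: F <= E} ->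
      nzd (idl (map (@old_form K n c) F)) (@old_form K n c e)) ->
  forall a b, idl (map (lss_form K c.+1) (enum E)) (a * b) ->
    idl (map (lss_form K c.+1) (enum E)) a \/ idl (map (lss_form K c.+1) (enum E)) b.
Proof.
move: {2}#|E| (leqnn #|E|) => m; elim: m E => [|m IHm] E leE Eu zE.
  move: leE; rewrite leqn0 cards_eq0 => /eqP ->; rewrite enum_set0 /= => a b /eqP.
  by rewrite mulf_eq0 => /orP[] /eqP ->; [left | right].
have [->|[e eE]] := set_0Vmem E.
  rewrite enum_set0 /= => a b /eqP.
  by rewrite mulf_eq0 => /orP[] /eqP ->; [left | right].
have [v ve] : exists v, v \in e by apply/set0Pn; rewrite -card_gt0 (Eu e eE).
pose E' := [set x in E | v \notin x].
have subE : {subset E' <= E} by move=> x; rewrite inE => /andP[].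
have ltE : (#|E'| <= m)%N.
  rewrite -ltnS; apply: leq_trans leE; apply: proper_card; apply/properP.
  split; first exact/subsetP.
  by exists e; rewrite // inE eE ve.
have prE' := IHm E' ltE (fun x xE => Eu x (subE x xE))
  (fun x F uF sF => zE x F uF (fun z zF => subE z (sF z zF))).
have eqE' p : idl (map (lss_form K c.+1) (enum E')) p <->
    idl (map (lss_form K c.+1) [seq x : {set 'I_n} <- enum E | v \notin x]) p.
  by split; apply: idl_subset => _ /mapP[x xE ->]; apply: map_f; move: xE;
    rewrite [_ \in enum (pred_of_set E')]mem_enum inE mem_filter mem_enum andbC.
apply: (vertex_prime k_gt0 Eu zE (v := v)).
  by move=> p q /eqE'/prE'[] /eqE'; [left | right].
by apply: form_proper Eu _ => x; rewrite mem_enum.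
Qed.

End Main.

Theorem theorem1p2 (K : fieldType) (n k d : nat) (E : {set {set 'I_n}})
    (n_ge1 : (1 <= n)%N) (k_ge1 : (1 <= k)%N) (d_ge2 : (2 <= d)%N)
    (E_uniform : uniform k E) :
  complete_intersection (lss_ideal K (d - 1) E) ->
  prime_ideal (lss_ideal K d E).
Proof.
case: d d_ge2 => // c c_gt0; rewrite subn1 /= => CI.
have old_nzd e F : uniq (e :: F) -> {subset e :: F <= E} ->
    nzd (idl (map (@old_form K n c) F)) (old_form K c e).
  move=> uF FE; rewrite /old_form (map_comp (inc_col K n c)).
  exact: nzd_inc_col (complete_intersection_nzd k_ge1 c_gt0 E_uniform CI uF FE).
have memE p : (p \in lss_ideal K c.+1 E) <-> idl (map (lss_form K c.+1) (enum E)) p.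
  exact: idlP.
have iI := idl_ideal (map (lss_form K c.+1) (enum E)).
split; first split.
- by apply/memE; apply: ideal0 iI.
- apply/negP => /memE; apply: (form_proper k_ge1 E_uniform) => e.
  by rewrite mem_enum.
- move=> a u v /memE Iu /memE Iv; apply/memE.
  exact: (idealD iI (ideal_mull iI a Iu) Iv).
- move=> u v /memE/(form_prime k_ge1 E_uniform old_nzd)[] /memE ->; first by [].
  exact: orbT.
Qed.
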